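(* Let $G$ be a finite simple graph and let $e=ij$ be an edge of $G$ with vertices $i$ and $j$. Let $G_e$ be the induced subgraph of $G$ on $i$, $j$ and all vertices of $G$ adjacent to both $i$ and $j$. Then \[\mathrm{reg}(G)\leq\max\{\mathrm{reg}(G-e),\ \mathrm{reg}(G_e-e)+1\}.\]
   Context: All graphs are finite and simple. $H-e$ denotes the graph obtained from $H$ by deleting the edge $e$ (but no vertices). Fix a field $k$ of characteristic $0$. For a graph $G$ with vertex set $[n]$, the non-edge ideal is $I(G)=\langle x_ix_j : i\neq j,\ ij\notin E(G)\rangle\subseteq k[x_1,\dots,x_n]$, and $\mathrm{reg}(G):=\max\{r : \beta_{i,i+r}(I(G))\neq 0 \text{ for some } i\}$ is its Castelnuovo-Mumford regularity, where $\beta_{i,j}$ are the graded Betti numbers. If $G$ is complete (so $I(G)=0$), $\mathrm{reg}(G)=1$ by convention. *)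

(* Defs.v *)
From mathcomp Require Import all_boot all_order all_algebra.
From mathcomp Require Import mpoly.
From Stdlib Require Import ClassicalEpsilon.

Set Implicit Arguments.
Unset Strict Implicit.
Unset Printing Implicit Defensive.

Import GRing.Theory.
Local Open Scope ring_scope.

Record sgraph (T : finType) := SGraph {
  adj :> rel T;
  adj_sym : ssrbool.symmetric adj;
  adj_irr : irreflexive adj
}.

Definition complete (T : finType) (G : sgraph T) : bool :=
  [forall u, forall v, (u != v) ==> G u v].

Section DeleteEdge.
Variables (T : finType) (G : sgraph T) (i j : T).

Definition del_adj : rel T :=
  fun u v => G u v && ([set u; v] != [set i; j]).

Lemma del_adj_sym : ssrbool.symmetric del_adj.
Proof. by move=> u v; rewrite /del_adj adj_sym setUC. Qed.

Lemma del_adj_irr : irreflexive del_adj.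
Proof. by move=> u; rewrite /del_adj adj_irr. Qed.

Definition del_edge : sgraph T := SGraph del_adj_sym del_adj_irr.
End DeleteEdge.

Section Induced.
Variables (T : finType) (G : sgraph T) (A : {set T}).

Definition induced_adj : rel {x : T | x \in A} := fun u v => G (val u) (val v).

Lemma induced_adj_sym : ssrbool.symmetric induced_adj.
Proof. by move=> u v; rewrite /induced_adj adj_sym. Qed.

Lemma induced_adj_irr : irreflexive induced_adj.
Proof. by move=> u; rewrite /induced_adj adj_irr. Qed.

Definition induced : sgraph {x : T | x \in A} :=
  SGraph induced_adj_sym induced_adj_irr.
End Induced.

Section EdgeNeighbourhood.
Variables (T : finType) (G : sgraph T) (i j : T).

Definition edge_nbhd : {set T} :=
  [set i; j] :|: [set v | G i v && G j v].

Lemma edge_nbhd_l : i \in edge_nbhd.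
Proof. by rewrite !inE eqxx. Qed.

Lemma edge_nbhd_r : j \in edge_nbhd.
Proof. by rewrite !inE eqxx orbT. Qed.

(* The graph G_e for e = ij. *)
Definition edge_graph : sgraph {x : T | x \in edge_nbhd} :=
  induced G edge_nbhd.

Definition edge_graph_l : {x : T | x \in edge_nbhd} := exist _ i edge_nbhd_l.
Definition edge_graph_r : {x : T | x \in edge_nbhd} := exist _ j edge_nbhd_r.

(* The graph G_e - e. *)
Definition edge_graph_del : sgraph {x : T | x \in edge_nbhd} :=
  del_edge edge_graph edge_graph_l edge_graph_r.
End EdgeNeighbourhood.

(* A minimal graded free resolution
     ... -> F_2 -> F_1 -> F_0 -> I -> 0
   of a homogeneous ideal I of S = k[x_0, ..., x_(n-1)].  The module F_p is
   the free module of row vectors of length [mfr_rank p], whose a-th basis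
   vector has degree [mfr_deg a], i.e. F_p = \bigoplus_a S(- mfr_deg a).
   Maps act by right multiplication.  Degrees in nat suffice: the
   generators of F_p have degree >= p, because I lies in S. *)
Record min_free_res (k : fieldType) (n : nat) (I : {mpoly k[n]} -> Prop) :=
MinFreeRes {
  mfr_rank : nat -> nat;
  mfr_deg : forall p, 'I_(mfr_rank p) -> nat;
  mfr_aug : 'cV[{mpoly k[n]}]_(mfr_rank 0);
  mfr_diff : forall p, 'M[{mpoly k[n]}]_(mfr_rank p.+1, mfr_rank p);
  (* All maps are homogeneous of degree 0.  For the differential, the entry
     (a, b) is homogeneous of degree deg a - deg b, and is 0 when this
     difference is negative. *)
  mfr_aug_homog : forall a, mfr_aug a ord0 \is (mfr_deg a).-homog;
  mfr_diff_homog : forall p a b m, m \in msupp (mfr_diff p a b) ->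
    (mdeg m + mfr_deg b)%N = mfr_deg a;
  mfr_exact_aug : forall f,
    I f <-> exists v : 'rV_(mfr_rank 0), (v *m mfr_aug) ord0 ord0 = f;
  mfr_exact0 : forall v : 'rV_(mfr_rank 0),
    v *m mfr_aug = 0 <-> exists w : 'rV_(mfr_rank 1), w *m mfr_diff 0 = v;
  mfr_exactS : forall p (v : 'rV_(mfr_rank p.+1)),
    v *m mfr_diff p = 0 <->
    exists w : 'rV_(mfr_rank p.+2), w *m mfr_diff p.+1 = v;
  (* Minimality: F_(p+1) is mapped into (x_0, ..., x_(n-1)) F_p. *)
  mfr_minimal : forall p a b, (mfr_diff p a b)@_0%MM = 0
}.

(* The graded Betti number beta_{p,q}(I): the number of generators of degree q
   in homological position p of a minimal graded free resolution of I.  It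
   does not depend on the resolution, so the description has a unique
   solution whenever I is a homogeneous ideal. *)
Definition betti (k : fieldType) (n : nat) (I : {mpoly k[n]} -> Prop)
    (p q : nat) : nat :=
  epsilon (inhabits 0%N) (fun b =>
    exists F : min_free_res I, b = #|[set a | @mfr_deg _ _ _ F p a == q]|).

Definition is_max (P : nat -> Prop) (r : nat) : Prop :=
  P r /\ forall s, P s -> (s <= r)%N.

(* The vertex v corresponds to the variable of index [enum_rank v]. *)
Definition nonedge_ideal (k : fieldType) (T : finType) (G : sgraph T)
    (f : {mpoly k[#|T|]}) : Prop :=
  exists c : T -> T -> {mpoly k[#|T|]},
    f = \sum_u \sum_(v | (u != v) && ~~ G u v)
          c u v * ('X_(enum_rank u) * 'X_(enum_rank v)).

(* Here r ranges over nat: beta_{p,q}(I) vanishes for q < p.  When G is not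
   complete, the maximum exists, since I(G) is nonzero and its resolution is
   finite. *)
Definition reg (k : fieldType) (T : finType) (G : sgraph T) : nat :=
  if complete G then 1%N
  else epsilon (inhabits 0%N) (is_max (fun r =>
    exists p, betti (@nonedge_ideal k T G) p (p + r) <> 0%N)).

(* Main.v *)
(** Koszul homology of a monomial ideal splits by multidegree, so the graded
    Betti number beta_(p,q) of a nonedge ideal is nonzero iff, for some vertex
    set W of size q, the simplicial complex of those A in W whose complement in
    W is not a clique has homology on faces of size p (Hochster's formula,
    Alexander dual form).  Betti numbers of an arbitrary minimal resolution are
    compared with Koszul homology by dimension shifting along its syzygies; the
    vanishing of Koszul homology in degrees q > n also bounds the degrees of the
    minimal generators of every syzygy module, so minimal resolutions exist.

    Deleting the edge ij adds to the complex of W the faces whose complement is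
    a clique through ij.  These contain all vertices of W outside G_e, and up to
    this shift the relative cycles on them bound in the cone with apex i; the
    boundary of the cone is a cycle for G_e - e.  So a class for G that dies for
    G - e yields a class for G_e - e with |W| - p smaller by one. *)
From HB Require Import structures.
Require Import Defs.
From mathcomp Require Import all_boot all_order all_algebra.
From mathcomp Require Import mpoly zify.
From Stdlib Require Import Classical ClassicalEpsilon.

Set Implicit Arguments.
Unset Strict Implicit.
Unset Printing Implicit Defensive.

Import GRing.Theory.
Local Open Scope ring_scope.

(** * Signed boundary operators *)

(* Signs are abstract, so that the complex of a graph on a subset of the
   vertices can reuse the signs of the ambient vertex set. *)
Definition alternating (T : finType) (sg : T -> {set T} -> bool) :=
  forall v w (A : {set T}), v != w -> v \notin A -> w \notin A ->
    (sg v A (+) sg w (v |: A)) (+) (sg w A (+) sg v (w |: A)).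

(** Off the diagonal the terms at [(v, w)] and [(w, v)] cancel. The diagonal needs its own
    hypothesis: antisymmetry alone gives only [f v v + f v v = 0]. *)
Lemma alternating_sum0 (T : finType) (V : zmodType) (f : T -> T -> V) :
    (forall v, f v v = 0) -> (forall v w, f v w = - f w v) ->
  \sum_v \sum_w f v w = 0.
Proof.
move=> f0 fN; pose lt (v w : T) := (enum_rank v < enum_rank w)%N.
have -> : \sum_v \sum_w f v w =
    \sum_v \sum_w (if lt v w then f v w else 0)
    + \sum_v \sum_w (if lt w v then f v w else 0).
  rewrite -big_split; apply: eq_bigr => v _; rewrite -big_split.
  apply: eq_bigr => w _ /=; rewrite /lt; case: ltngtP => [_|_|e].
  - by rewrite addr0.
  - by rewrite add0r.
  by rewrite addr0 (enum_rank_inj (val_inj e)) f0.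
rewrite [X in _ + X]exchange_big /= -big_split /= big1 // => v _.
rewrite -big_split /= big1 // => w _; case: ifP => _; last by rewrite addr0.
by rewrite (fN v w) addNr.
Qed.

Section Boundary.
Variables (T : finType) (sg : T -> {set T} -> bool).
Hypothesis altsg : alternating sg.

Section General.
Variables (R : comNzRingType) (L : lmodType R) (x : T -> R).

(** A chain is the function of its coefficients, so the coefficient of [A] in the boundary collects
    the sets [v |: A]. With [x] constantly 1 this is the simplicial boundary; with [x] the variables
    it is the Koszul differential. *)
Definition bd (c : {set T} -> L) (A : {set T}) : L :=
  \sum_(v | v \notin A) ((-1) ^+ sg v A * x v) *: c (v |: A).

Lemma eq_bd c1 c2 : c1 =1 c2 -> bd c1 =1 bd c2.
Proof. by move=> e A; apply: eq_bigr => v _; rewrite e. Qed.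

Lemma bdB c1 c2 A : bd (fun B => c1 B - c2 B) A = bd c1 A - bd c2 A.
Proof. by rewrite /bd -sumrB; apply: eq_bigr => v _; rewrite scalerBr. Qed.

Lemma bd_bd c A : bd (bd c) A = 0.
Proof.
(* The double sum, extended by zero to all pairs; [altsg] makes it antisymmetric. *)
pose f v w := if [&& v \notin A, w \notin A & v != w] then
  (((-1) ^+ sg v A * x v) * ((-1) ^+ sg w (v |: A) * x w)) *: c (v |: (w |: A))
  else 0.
rewrite -[RHS](@alternating_sum0 _ _ f); first last.
- move=> v w; rewrite /f andbCA (eq_sym w); case: ifP => [/and3P[wA vA ne]|_];
  last by rewrite oppr0.
  rewrite setUCA -scaleNr; congr (_ *: _).
  rewrite mulrACA -signr_addb [in RHS]mulrACA -signr_addb (mulrC (x w)).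
  move: (altsg ne vA wA); case: (sg v A (+) _); case: (sg w A (+) _) => //= _;
    by rewrite ?expr0 ?expr1 ?mulN1r ?mul1r ?opprK.
- by move=> v; rewrite /f eqxx !andbF.
rewrite {1}/bd big_mkcond; apply: eq_bigr => v _; case: ifP => [vA|nvA]; last first.
  by rewrite big1 // => w _; rewrite /f nvA.
rewrite scaler_sumr big_mkcond; apply: eq_bigr => w _.
rewrite !inE negb_or /f vA /= eq_sym andbC; case: ifP => // _.
by rewrite scalerA setUCA.
Qed.

End General.

Section Cone.
Variables (k : fieldType).
Local Notation sbd := (@bd k k^o (fun=> 1)).

Definition cone (v : T) (c : {set T} -> k^o) (A : {set T}) : k^o :=
  if v \in A then (-1) ^+ sg v (A :\ v) * c (A :\ v) else 0.

(** This is the homotopy identity [bd h + h bd = id] for [h = cone v]. At sets avoiding [v] only the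
    summand of [v] survives; at sets containing [v] the other summands cancel by alternation. *)
Lemma bd_cone v c A : sbd (cone v c) A = c A - cone v (sbd c) A.
Proof.
rewrite /cone; case: ifP => [vA|/negbT vA]; last first.
  rewrite subr0 /bd (bigD1 v) //= setU11 setU1K // big1 ?addr0 => [|w].
    by rewrite mulr1 /GRing.scale /= mulrA -signr_addb addbb mul1r.
  by move=> /andP[wA wv];
    rewrite in_setU1 (eq_sym v w) (negPf wv) (negPf vA) scaler0.
rewrite {2}/bd (bigD1 v) ?setD11 //= setD1K // mulr1 mulrDr /GRing.scale /=.
rewrite mulrA -signr_addb addbb mul1r opprD addNKr /bd mulr_sumr -sumrN.
apply: eq_big => [w|w wA]; first by rewrite !inE negb_and negbK;
  case: eqVneq => [->|_]; rewrite ?vA ?andbT.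
have wv : w != v by apply: contraNneq wA => ->.
have vB : v \notin A :\ v by rewrite setD11.
have wB : w \notin A :\ v by rewrite in_setD1 negb_and wA orbT.
rewrite in_setU1 vA orbT !mulr1 /GRing.scale /=.
have -> : (w |: A) :\ v = w |: A :\ v.
  by apply/setP=> u; rewrite !inE; case: (eqVneq u v) => [->|_];
    rewrite ?(eq_sym v w) ?(negPf wv).
rewrite !mulrA -!signr_addb -mulNr; congr (_ * _).
have := altsg wv wB vB; rewrite setD1K //.
by case: (sg w A); case: (sg w _); case: (sg v (A :\ v)); case: (sg v _) => //= _;
  rewrite ?expr0 ?expr1 ?opprK.
Qed.

(* A chain in homological position [p] is supported on sets of cardinality [p];
   with [p = 0] the homology is the reduced one. *)
Definition schain (P : pred {set T}) p (c : {set T} -> k^o) :=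
  forall A, c A != 0 -> P A && (#|A| == p).

Definition sacyc (P : pred {set T}) p :=
  forall c, schain P p c -> (forall A, sbd c A = 0) ->
  exists2 b, schain P p.+1 b & forall A, sbd b A = c A.

(** A family closed under adding [v] is preserved by the contracting homotopy [cone v]. *)
Lemma sacyc_cone (P : pred {set T}) p v :
  (forall A, P A -> P (v |: A)) -> sacyc P p.
Proof.
move=> Pv c cP c0; exists (cone v c) => [A|A]; last first.
  by rewrite bd_cone /cone c0 mulr0 if_same subr0.
rewrite /cone; case: ifP => [vA|]; last by rewrite eqxx.
rewrite mulf_eq0 negb_or => /andP[_ /cP /andP[PA /eqP <-]].
by rewrite -{1}(setD1K vA) Pv //= (cardsD1 v A) vA.
Qed.

Lemma eq_sacyc P Q p : P =1 Q -> sacyc P p -> sacyc Q p.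
Proof.
move=> PQ aP c cQ c0; case: (aP c) => // [A /cQ|b bP bc]; first by rewrite PQ.
by exists b => // A /bP; rewrite PQ.
Qed.

End Cone.
End Boundary.

(** * Multigraded decomposition of Koszul chains *)

Lemma functional_choice_rel (A B : Type) (R : A -> B -> Prop) :
  (forall a, exists b, R a b) -> exists f, forall a, R a (f a).
Proof.
move=> h; exists (fun a => proj1_sig (constructive_indefinite_description _ (h a))).
by move=> a; case: constructive_indefinite_description.
Qed.

Section Multidegree.
Variables (T : finType).
Implicit Types (A : {set T}) (v : T) (m : 'X_{1..#|T|}).

Definition mset A : 'X_{1..#|T|} := [multinom (enum_val i \in A : nat) | i < #|T|].

Lemma msetE A v : mset A (enum_rank v) = (v \in A).
Proof. by rewrite mnmE enum_rankK. Qed.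

Lemma mnm_rankP m1 m2 :
  (forall v, m1 (enum_rank v) = m2 (enum_rank v)) -> m1 = m2.
Proof. by move=> e; apply/mnmP => i; rewrite -(enum_valK i) e. Qed.

Lemma mset0 : mset set0 = 0%MM.
Proof. by apply: mnm_rankP => v; rewrite msetE inE mnm0E. Qed.

Lemma msetU1 v A : v \notin A -> mset (v |: A) = (mset A + U_(enum_rank v))%MM.
Proof.
move=> vA; apply: mnm_rankP => w; rewrite mnmDE !msetE mnm1E in_setU1 eq_sym.
by rewrite (inj_eq enum_rank_inj); case: eqVneq => [<-|_];
  rewrite ?(negPf vA) ?addn0.
Qed.

Lemma mdeg_rank m : mdeg m = (\sum_v m (enum_rank v))%N.
Proof. by rewrite mdegE (reindex (@enum_rank T)) //; apply/onW_bij/enum_rank_bij.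
Qed.

Lemma mdeg_mset A : mdeg (mset A) = #|A|.
Proof.
rewrite mdeg_rank -sum1_card [RHS]big_mkcond; apply: eq_bigr => v _.
by rewrite msetE; case: (v \in A).
Qed.

Definition msup m : {set T} := [set v | m (enum_rank v) != 0%N].

Lemma mset_le A m : (mset A <= m)%MM = (A \subset msup m).
Proof.
apply/mnm_lepP/subsetP => [h v vA|h i].
  by rewrite inE -lt0n (leq_trans _ (h _)) // msetE vA.
rewrite -(enum_valK i) msetE; case vA: (_ \in A) => //.
by have := h _ vA; rewrite inE lt0n.
Qed.

Lemma msup_subU1 v A m : v \notin A ->
  (v |: A \subset msup m) = (A \subset msup m) && ((m - mset A)%MM (enum_rank v) != 0%N).
Proof.
move=> vA; rewrite subUset sub1set andbC; congr (_ && _).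
by rewrite mnmBE msetE (negPf vA) subn0 inE.
Qed.

Lemma msup_addset A m : A \subset msup (m + mset A).
Proof. by rewrite -mset_le lem_addl. Qed.

Variable k : fieldType.
Local Notation S := {mpoly k[#|T|]}.

Lemma mcoeff_XM (p : S) i m :
  ('X_i * p)@_m = if m i != 0%N then p@_(m - U_(i)) else 0.
Proof.
rewrite mulrC -lep1mP; case: ifP => [le|nle].
  by rewrite -{1}(submK le) addmC mcoeffMX.
apply: memN_msupp_eq0; rewrite (perm_mem (msuppMX _ _)).
by apply/mapP => -[m' _ e]; rewrite e lem_addr in nle.
Qed.

Lemma mcoeff_boundedsum (E : 'X_{1..#|T|} -> k) N m :
    (forall m, E m != 0 -> (mdeg m < N)%N) ->
  (\sum_(m : 'X_{1..#|T| < N}) E m *: 'X_[m])@_m = E m.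
Proof.
move=> h; have [lt|le] := ltnP (mdeg m) N; first by rewrite mcoeff_mpoly.
have -> : E m = 0 by apply/eqP; apply: contraLR le => /h; rewrite -ltnNge.
rewrite raddf_sum big1 // => m' _ /=; rewrite mcoeffZ mcoeffX.
case: eqP => [e|_]; last by rewrite mulr0.
by move: (bmdeg m'); rewrite e ltnNge le.
Qed.

Definition xvar (v : T) : S := 'X_(enum_rank v).

Variable sg : T -> {set T} -> bool.

Local Notation kbd := (@bd T sg S S^o xvar).
Local Notation sbd := (@bd T sg k k^o (fun=> 1)).

(** The Koszul basis element of [A] has multidegree [mset A], so the multidegree [m] part of [c] has
    at [A] the monomial [m - mset A]. The guard is needed because subtraction of exponents is
    truncated. *)
Definition mcomp m (c : {set T} -> S^o) A : k^o :=
  if A \subset msup m then (c A)@_(m - mset A) else 0.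

(** Trading the vertex [v] for the variable [x_v] keeps the multidegree, so in each multidegree the
    Koszul differential is the simplicial boundary. *)
Lemma mcomp_bd m c A : mcomp m (kbd c) A = sbd (mcomp m c) A.
Proof.
rewrite /mcomp /bd; case: ifP => [sA|nsA]; last first.
  rewrite big1 // => v vA; rewrite msup_subU1 // nsA /= scaler0 //.
rewrite raddf_sum; apply: eq_bigr => v vA /=.
rewrite msup_subU1 // sA /= mulr1 /GRing.scale /= -mulrA !mulr_sign msetU1 // -submDA.
have -> : forall p : S, (if sg v A then - p else p)@_(m - mset A) =
    if sg v A then - p@_(m - mset A) else p@_(m - mset A).
  by move=> p; case: (sg v A); rewrite ?mcoeffN.
by rewrite mcoeff_XM.
Qed.

Lemma mcoeff_mcomp m (c : {set T} -> S^o) A : (c A)@_m = mcomp (m + mset A)%MM c A.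
Proof. by rewrite /mcomp msup_addset addmK. Qed.

Lemma mcompP (c1 c2 : {set T} -> S^o) A :
  (forall m, mcomp m c1 A = mcomp m c2 A) -> c1 A = c2 A.
Proof. by move=> h; apply/mpolyP => m; rewrite !mcoeff_mcomp h. Qed.

(* Degree-[q] Koszul chains with coefficients in the span of the monomials
   satisfying [M], where the generator of the coefficient module has degree [t]. *)
Definition pchain (M : pred 'X_{1..#|T|}) t p q (c : {set T} -> S^o) :=
  forall A m, (c A)@_m != 0 -> [&& M m, (mdeg m + #|A| + t == q)%N & #|A| == p].

(** When [M] is the set of monomials of an ideal, this is its upper Koszul simplicial complex in
    multidegree [m]. *)
Definition mfamily (M : pred 'X_{1..#|T|}) m : pred {set T} :=
  fun A => (A \subset msup m) && M (m - mset A)%MM.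

Definition pacyc M t p q := forall c, pchain M t p q c -> (forall A, kbd c A = 0) ->
  exists2 b, pchain M t p.+1 q b & forall A, kbd b A = c A.

(** The bounding chain is found separately in each multidegree of the right total degree; the bound
    on degrees makes each coefficient of their sum a polynomial. *)
Lemma pacyc_of_sacyc M t p q :
    (forall m, (mdeg m + t)%N = q -> sacyc sg k (mfamily M m) p) ->
  pacyc M t p q.
Proof.
move=> ac c cM c0.
have mc m : (mdeg m + t)%N = q -> schain (mfamily M m) p (mcomp m c).
  move=> _ A; rewrite /mcomp /mfamily; case: ifP => [sA|_]; last by rewrite eqxx.
  by move=> /cM /and3P[-> _ ->].
have /functional_choice_rel[b bP] : forall m, exists b, (mdeg m + t)%N = q ->
    schain (mfamily M m) p.+1 b /\ forall A, sbd b A = mcomp m c A.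
  move=> m; have [e|ne] := eqVneq (mdeg m + t)%N q; last first.
    by exists (fun=> 0) => e; rewrite e eqxx in ne.
  have [|A|b bM bc] := ac m e (mcomp m c); first exact: mc.
    by rewrite -mcomp_bd /mcomp c0 mcoeff0 if_same.
  by exists b.
pose E A m := if (mdeg m + #|A| + t == q)%N then b (m + mset A)%MM A else 0.
pose B A : S^o := \sum_(m : 'X_{1..#|T| < q.+1}) E A m *: 'X_[m].
have BE A m : (B A)@_m = E A m.
  apply: mcoeff_boundedsum => m'; rewrite /E; case: ifP => [/eqP <- _|_];
    last by rewrite eqxx.
  by rewrite ltnS -addnA leq_addr.
have mB m A : mcomp m B A = if (mdeg m + t == q)%N then b m A else 0.
  rewrite /mcomp; case: ifP => [sA|nsA].
    rewrite BE /E submK ?mset_le // -mdeg_mset -mdegD submK ?mset_le //.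
  case: ifP => // /eqP /bP[bM _]; have [<-//|/eqP] := eqVneq 0 (b m A).
  by move/eqP; rewrite eq_sym => /bM /andP[]; rewrite /mfamily nsA.
exists B => [A m|A].
  rewrite mcoeff_mcomp mB mdegD mdeg_mset; case: ifP => [e|_]; last by rewrite eqxx.
  have /bP[bM _] : (mdeg (m + mset A) + t)%N = q by apply/eqP;
    rewrite mdegD mdeg_mset.
  by move=> /bM; rewrite /mfamily addmK => /andP[/andP[_ ->] ->].
apply: mcompP => m; rewrite mcomp_bd (eq_bd _ _ (mB m)).
case: (eqVneq (mdeg m + t)%N q) => [e|ne]; first by have [_ ->] := bP _ e.
rewrite /bd big1 => [|v _]; last by rewrite scaler0.
rewrite /mcomp; case: ifP => // sA; apply/esym/eqP;
  apply: contraNT ne => /cM /and3P[_ + _].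
by rewrite -mdeg_mset -mdegD submK ?mset_le.
Qed.

(** A scalar cycle is placed in multidegree [m], bounded there by a Koszul chain, and the
    multidegree [m] part of that chain is kept. *)
Lemma sacyc_of_pacyc M t p q m : (mdeg m + t)%N = q ->
  pacyc M t p q -> sacyc sg k (mfamily M m) p.
Proof.
move=> mq ac c cM c0.
pose C A : S^o := c A *: 'X_[m - mset A].
have mC m' A : mcomp m' C A = if m' == m then c A else 0.
  rewrite /mcomp /C; have [c0A|/cM /andP[/andP[sA _] _]] := eqVneq (c A) 0.
    by rewrite c0A scale0r mcoeff0 !if_same.
  case: (eqVneq m' m) => [->|ne]; first by rewrite sA mcoeffZ mcoeffX eqxx mulr1.
  case: ifP => // sA'; rewrite mcoeffZ mcoeffX; case: eqP => [e|_];
    last by rewrite mulr0.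
  case/eqP: ne; rewrite -(@submK _ (mset A) m') ?mset_le // -e submK // mset_le //.
have [A m'|A|b bM bc] := ac C.
- rewrite mcoeff_mcomp mC; case: ifP => [/eqP e nz|_]; last by rewrite eqxx.
  have := cM A nz; rewrite /mfamily -e addmK => /andP[/andP[_ ->] ->].
  by rewrite -[X in (_ + X + _)%N]mdeg_mset -mdegD e mq eqxx.
- apply: (mcompP (c2 := fun=> 0)) => m';
  rewrite mcomp_bd (eq_bd _ _ (mC m')) [RHS]/mcomp mcoeff0 if_same.
  case: (m' == m); first exact: c0.
  by rewrite /bd big1 // => v _; rewrite scaler0.
exists (mcomp m b) => A; last first.
  by rewrite -mcomp_bd; have := mC m A; rewrite eqxx => <-; rewrite /mcomp bc.
rewrite /mcomp /mfamily; case: ifP => [sA|]; last by rewrite eqxx.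
by move=> /bM /and3P[-> _ ->].
Qed.

End Multidegree.

(** * Koszul homology of graded submodules *)

Section Graded.
Variables (T : finType) (k : fieldType).
Local Notation S := {mpoly k[#|T|]}.

(** Degree-[q] part of [p] times a generator of degree [t]; comparing sums of degrees gives zero
    when [t] exceeds [q]. *)
Definition homog_part t q (p : S) : S :=
  \sum_(m : 'X_{1..#|T| < q.+1}) (if (mdeg m + t == q)%N then p@_m else 0) *: 'X_[m].

Lemma mcoeff_homog_part t q p m : (homog_part t q p)@_m = if (mdeg m + t == q)%N then p@_m else 0.
Proof.
apply: (mcoeff_boundedsum (E := fun m => if (mdeg m + t == q)%N then p@_m else 0)) => m'.
by case: ifP => [/eqP <- _|]; rewrite ?eqxx // ltnS leq_addr.
Qed.

Lemma homog_partM t t' q p h : (forall m, h@_m != 0 -> (mdeg m + t)%N = t') ->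
  homog_part t q (p * h) = homog_part t' q p * h.
Proof.
move=> hh; apply/mpolyP => m; rewrite mcoeff_homog_part !mcoeffM.
have key m1 m2 : m = (m1 + m2)%MM ->
    (homog_part t' q p)@_m1 * h@_m2 = if (mdeg m + t == q)%N then p@_m1 * h@_m2 else 0.
  move=> ->; have [->|/hh <-] := eqVneq (h@_m2) 0; first by rewrite !mulr0 if_same.
  by rewrite mcoeff_homog_part mdegD addnA; case: ifP; rewrite ?mul0r.
case: ifP key => _ key; first by apply: eq_bigr => l /eqP /key.
by rewrite big1 // => l /eqP /key.
Qed.

(** The shift [s] accounts for the degree of the exterior factor of a Koszul chain; [s = 0] is the
    plain graded projection. *)
Definition hproj r (d : 'I_r -> nat) s q (v : 'rV[S]_r) : 'rV[S]_r :=
  \row_b homog_part (d b + s) q (v 0 b).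

Lemma hprojP r (d : 'I_r -> nat) s q v :
  (hproj d s q v = v) <->
  (forall b m, (v 0 b)@_m != 0 -> (mdeg m + (d b + s))%N = q).
Proof.
split=> [<- b m|h]; first by rewrite mxE mcoeff_homog_part; case: ifP => [/eqP|];
  rewrite ?eqxx.
apply/rowP => b; apply/mpolyP => m; rewrite mxE mcoeff_homog_part.
by case: eqP => // ne; have [->//|/h] := eqVneq ((v 0 b)@_m) 0.
Qed.

Lemma homog_partB t q : {morph homog_part t q : u v / u - v}.
Proof.
move=> u v; apply/mpolyP => m; rewrite mcoeffB !mcoeff_homog_part mcoeffB.
by case: ifP; rewrite ?subr0.
Qed.

Lemma hprojB r (d : 'I_r -> nat) s q : {morph hproj d s q : u v / u - v}.
Proof. by move=> u v; apply/rowP => b; rewrite !mxE homog_partB. Qed.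

HB.instance Definition _ t q := GRing.isAdditive.Build S S (homog_part t q) (@homog_partB t q).
HB.instance Definition _ r (d : 'I_r -> nat) s q :=
  GRing.isAdditive.Build 'rV[S]_r 'rV[S]_r (hproj d s q) (@hprojB r d s q).

Lemma hproj_id r (d : 'I_r -> nat) s q v : hproj d s q (hproj d s q v) = hproj d s q v.
Proof. by apply/hprojP => b m; rewrite mxE mcoeff_homog_part; case: ifP => [/eqP|];
  rewrite ?eqxx. Qed.

Lemma hprojZ r (d : 'I_r -> nat) s s' q a v :
    (forall m, a@_m != 0 -> (mdeg m + s)%N = s') ->
  hproj d s q (a *: v) = a *: hproj d s' q v.
Proof.
move=> ha; apply/rowP => b; rewrite !mxE [in LHS]mulrC [in RHS]mulrC;
  apply: homog_partM => m /ha <-.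
by rewrite addnCA.
Qed.

Definition mxhomog r r' (d : 'I_r -> nat) (d' : 'I_r' -> nat) (M : 'M[S]_(r, r')) :=
  forall a b m, (M a b)@_m != 0 -> (mdeg m + d' b)%N = d a.

Lemma hprojM r r' (d : 'I_r -> nat) (d' : 'I_r' -> nat) M s q v : mxhomog d d' M ->
  hproj d' s q (v *m M) = hproj d s q v *m M.
Proof.
move=> hM; apply/rowP => b; rewrite !mxE raddf_sum; apply: eq_bigr => a _ /=.
by rewrite mxE; apply: homog_partM => m /hM <-; rewrite addnA.
Qed.

Definition submodule r (Z : 'rV[S]_r -> Prop) :=
  Z 0 /\ forall a v w, Z v -> Z w -> Z (a *: v + w).

Lemma submodule_sum r (Z : 'rV[S]_r -> Prop) (I : Type) (s : seq I) (P : pred I) a v :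
  submodule Z -> (forall i, P i -> Z (v i)) -> Z (\sum_(i <- s | P i) a i *: v i).
Proof.
by move=> [Z0 ZD] h; elim/big_rec: _ => // i w /h Zv; apply: ZD.
Qed.

Definition kermod r r' (M : 'M[S]_(r, r')) (v : 'rV[S]_r) := v *m M = 0.
Definition immod r r' (M : 'M[S]_(r, r')) (v : 'rV[S]_r') := exists w, v = w *m M.

Lemma kermod_submodule r r' (M : 'M[S]_(r, r')) : submodule (kermod M).
Proof.
split=> [|a v w]; rewrite /kermod ?mul0mx // mulmxDl -scalemxAl => -> ->.
by rewrite scaler0 addr0.
Qed.

Lemma immod_submodule r r' (M : 'M[S]_(r, r')) : submodule (immod M).
Proof.
split=> [|a _ _ [v ->] [w ->]]; first by exists 0; rewrite mul0mx.
by exists (a *: v + w); rewrite mulmxDl -scalemxAl.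
Qed.

Definition truemod r (v : 'rV[S]_r) := True.

Lemma truemod_submodule r : submodule (@truemod r).
Proof. by []. Qed.

Variable sg : T -> {set T} -> bool.
Hypothesis altsg : alternating sg.

Local Notation kbd := (@bd T sg S _ (@xvar T k)).

Definition kchain r (d : 'I_r -> nat) (Z : 'rV[S]_r -> Prop) p q
    (c : {set T} -> 'rV[S]_r) :=
  forall A, [/\ Z (c A), hproj d #|A| q (c A) = c A & #|A| != p -> c A = 0].

(** Vanishing of the Koszul homology of [Z] at position [p] in degree [q], that is, of the
    degree-[q] part of Tor of [Z] with the residue field. *)
Definition kacyc r (d : 'I_r -> nat) (Z : 'rV[S]_r -> Prop) p q :=
  forall c, kchain d Z p q c -> (forall A, kbd c A = 0) ->
  exists2 b, kchain d Z p.+1 q b & forall A, kbd b A = c A.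

Lemma eq_kacyc r (d : 'I_r -> nat) Z Z' p q : (forall v, Z v <-> Z' v) ->
  kacyc d Z p q -> kacyc d Z' p q.
Proof.
move=> e ac c cZ c0; case: (ac c) => // [A|b bZ bc].
  by have [/e] := cZ A.
by exists b => // A; have [/e] := bZ A.
Qed.

Lemma kchainB r (d : 'I_r -> nat) Z p q c1 c2 : submodule Z ->
  kchain d Z p q c1 -> kchain d Z p q c2 -> kchain d Z p q (fun A => c1 A - c2 A).
Proof.
move=> [Z0 ZD] h1 h2 A; have [Z1 e1 n1] := h1 A; have [Z2 e2 n2] := h2 A.
split; first by rewrite addrC -scaleN1r; apply: ZD.
- by rewrite raddfB /= e1 e2.
- by move=> ne; rewrite n1 // n2 // subr0.
Qed.

Lemma mcoeff_signXvar s (v : T) m :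
  ((-1) ^+ s * xvar k v)@_m != 0 -> mdeg m = 1%N.
Proof.
rewrite -signr_odd mulr_sign; case: (odd s); rewrite ?mcoeffN mcoeffX;
 by case: (eqVneq U_(enum_rank v)%MM m) => [<- _|_]; rewrite ?mdeg1 ?oppr0 ?eqxx.
Qed.

Lemma kchain_bd r (d : 'I_r -> nat) Z p q c : submodule Z ->
  kchain d Z p.+1 q c -> kchain d Z p q (kbd c).
Proof.
move=> Zs cZ A; split.
- by apply: submodule_sum => // v _; have [] := cZ (v |: A).
- rewrite raddf_sum; apply: eq_bigr => v vA /=; rewrite (@hprojZ _ _ #|A| #|A|.+1).
    by have [_ + _] := cZ (v |: A); rewrite cardsU1 vA => ->.
  by move=> m /mcoeff_signXvar ->.
- move=> ne; rewrite /bd big1 // => v vA; have [_ _ ->] := cZ (v |: A);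
  first by rewrite scaler0.
  by rewrite cardsU1 vA.
Qed.

Lemma kbd_mulmx r r' (M : 'M[S]_(r, r')) (c : {set T} -> 'rV[S]_r) A :
  kbd (fun B => c B *m M) A = kbd c A *m M.
Proof. by rewrite /bd mulmx_suml; apply: eq_bigr => v _; rewrite scalemxAl. Qed.

Lemma kbd_comp r (c : {set T} -> 'rV[S]_r) A b :
  kbd c A 0 b = @bd T sg S S^o (@xvar T k) (fun B => c B 0 b) A.
Proof. by rewrite /bd summxE; apply: eq_bigr => v _; rewrite mxE. Qed.

Lemma kbd_const r (c : {set T} -> 'rV[S]_r) A b : (kbd c A 0 b)@_0%MM = 0.
Proof.
rewrite kbd_comp /bd raddf_sum big1 // => v _ /=.
by rewrite /GRing.scale /= mulrAC mulrC mcoeff_XM mnm0E.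
Qed.

Lemma kbd_position r (d : 'I_r -> nat) Z q c A : kchain d Z 0 q c -> kbd c A = 0.
Proof.
move=> cZ; rewrite /bd big1 // => v vA; have [_ _ ->] := cZ (v |: A);
  first by rewrite scaler0.
by rewrite cardsU1 vA.
Qed.

(** In a nonzero multidegree all subsets of the support form a cone. Multidegree zero carries only
    the constants at position 0, which the last hypothesis excludes. *)
Lemma kchain_free_exact r (d : 'I_r -> nat) p q c :
    kchain d (@truemod r) p q c -> (forall A, kbd c A = 0) ->
    (0 < p)%N \/ (forall A b, (c A 0 b)@_0%MM = 0) ->
  exists2 b, kchain d (@truemod r) p.+1 q b & forall A, kbd b A = c A.
Proof.
move=> cZ c0 pos.
have cp b : pchain predT (d b) p q (fun A => c A 0 b).
  move=> A m nz; have [_ /hprojP/(_ _ _ nz) e n] := cZ A.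
  rewrite /= addnAC -addnA e eqxx /=; apply: contraR nz => /n ->.
  by rewrite mxE mcoeff0.
have /functional_choice_rel[f fP] : forall b, exists f, pchain predT (d b) p.+1 q f /\
    forall A, @bd T sg S S^o (@xvar T k) f A = c A 0 b.
  (* If the generator [b] has degree [q], only multidegree zero occurs, and the chain vanishes
     there. *)
  move=> b; have [e|ne] := eqVneq (d b) q.
    exists (fun=> 0); split=> [A m|A]; first by rewrite mcoeff0 eqxx.
    rewrite /bd big1 => [|v _]; last by rewrite scaler0.
    apply/esym/eqP; apply: contraT => nz.
    have [m nzm] : exists m, (c A 0 b)@_m != 0.
      by exists (mlead (c A 0 b)); rewrite mleadc_eq0.
    have /and3P[_ /eqP dm /eqP Ap] := cp b A m nzm.
    have [m0 A0] : mdeg m = 0%N /\ #|A| = 0%N by lia.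
    case: pos => [|z]; first by rewrite -Ap A0.
    by move/eqP: m0 nzm; rewrite mdeg_eq0 => /eqP ->; rewrite z eqxx.
  have ac m : (mdeg m + d b)%N = q -> sacyc sg k (mfamily predT m) p.
    move=> mq; have : m != 0%MM by apply: contraNneq ne => m0; rewrite -mq m0 mdeg0.
    have [z|[v]] := set_0Vmem (msup m); last rewrite inE => vm _.
      case/eqP; apply: mnm_rankP => v; rewrite mnm0E; apply/eqP.
      by have := in_set0 v; rewrite -z inE => /negbFE.
    by apply: (sacyc_cone altsg (v := v)) => A;
      rewrite /mfamily !andbT subUset sub1set inE vm.
  case: (pacyc_of_sacyc ac (cp b)) => [A|f fp fc]; first by rewrite -kbd_comp c0 mxE.
  by exists f.
exists (fun A => \row_b (f b A : S)) => A; last first.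
  apply/rowP => b; have [_ <-] := fP b; rewrite kbd_comp.
  by rewrite (eq_bd _ _ (c2 := f b)) // => B; rewrite mxE.
split=> //; first apply/hprojP => b m; rewrite ?mxE.
  by have [fp _] := fP b => /fp /and3P[_ /eqP <- _]; lia.
move=> ne; apply/rowP => b; rewrite !mxE; apply/eqP; rewrite -mleadc_eq0.
have [fp _] := fP b; apply: contraNT ne => /fp; lia.
Qed.

Lemma kchain_lift r r' (d : 'I_r -> nat) (d' : 'I_r' -> nat) M p q y :
    mxhomog d d' M -> kchain d' (immod M) p q y ->
  exists2 f, kchain d (@truemod r) p q f & forall A, f A *m M = y A.
Proof.
move=> hM yM.
have /functional_choice_rel[f fP] A : exists f : 'rV[S]_r,
    f *m M = y A /\ (#|A| != p -> f = 0).
  have [[w e] _ n] := yM A; have [Ap|/n ->] := eqVneq #|A| p; first by exists w.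
  by exists 0; rewrite mul0mx.
(* The chosen preimages need not be homogeneous; their degree-[q] parts still lift [y] because [M]
   is homogeneous. *)
exists (fun A : {set T} => hproj d #|A| q (f A)) => A.
  by split=> // [|/(proj2 (fP A)) ->]; rewrite ?hproj_id ?raddf0.
by rewrite -(hprojM _ _ _ hM); have [-> _] := fP A; have [_ ->] := yM A.
Qed.

Lemma kchain_mulmx r r' (d : 'I_r -> nat) (d' : 'I_r' -> nat) M p q Z f :
    mxhomog d d' M -> kchain d Z p q f ->
  kchain d' (immod M) p q (fun A => f A *m M).
Proof.
move=> hM fZ A; have [_ e n] := fZ A; split; first by exists (f A).
- by rewrite (hprojM _ _ _ hM) e.
- by move=> /n ->; rewrite mul0mx.
Qed.

Lemma kchainW r (d : 'I_r -> nat) Z p q c :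
  kchain d Z p q c -> kchain d (@truemod r) p q c.
Proof. by move=> cZ A; have [] := cZ A. Qed.

(** * Dimension shifting between the kernel and the image of a homogeneous matrix *)

Section Shift.
Variables (r r' : nat) (d : 'I_r -> nat) (d' : 'I_r' -> nat) (M : 'M[S]_(r, r')).
Hypothesis hM : mxhomog d d' M.

(** The rows of [M] generate minimally: no syzygy has an entry with a nonzero constant term, so no
    row is redundant. *)
Definition mxminimal := forall v, kermod M v -> forall b, (v 0 b)@_0%MM = 0.

(** Diagram chase for the short exact sequence of kernel, free module and image, the free module
    being acyclic in positive positions. *)
Lemma kacyc_im_of_ker i q : kacyc d (kermod M) i q -> kacyc d' (immod M) i.+1 q.
Proof.
move=> ac y yM y0; have [f fT fM] := kchain_lift hM yM.
have fb A : kbd f A *m M = 0 by rewrite -kbd_mulmx (eq_bd _ _ fM) y0.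
have [A|A|z zM zc] := ac (kbd f).
- by have [_ ? ?] := kchain_bd (truemod_submodule r) fT A; split=> //; apply: fb.
- exact: bd_bd.
have [||g gT gc] := kchain_free_exact (kchainB (truemod_submodule r) fT (kchainW zM)).
- by move=> A; rewrite bdB zc subrr.
- by left.
exists (fun A => g A *m M) => [|A]; first exact: kchain_mulmx gT.
rewrite kbd_mulmx gc mulmxBl fM; have [zA _ _] := zM A.
by rewrite (zA : _ = 0) subr0.
Qed.

(** The reverse chase. At position 0 the cycle must bound in the free module, which minimality
    ensures by removing constant terms. *)
Lemma kacyc_ker_of_im i q : (0 < i)%N \/ mxminimal ->
  kacyc d' (immod M) i.+1 q -> kacyc d (kermod M) i q.
Proof.
move=> im ac z zM z0.
have [|f fT fz] := kchain_free_exact (kchainW zM) z0.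
  by case: im => [|h]; [left | right => A b; have [/h] := zM A].
have [A|y yM yc] := ac _ (kchain_mulmx hM fT).
- rewrite kbd_mulmx fz; have [zA _ _] := zM A; exact: zA.
have [g gT gM] := kchain_lift hM yM.
exists (fun A => f A - kbd g A) => [A|A]; last by rewrite bdB (bd_bd altsg) subr0.
have [_ e n] := kchainB (truemod_submodule r) fT (kchain_bd (truemod_submodule r) gT) A.
by split=> //; rewrite /kermod mulmxBl -kbd_mulmx (eq_bd _ _ gM) yc subrr.
Qed.

(** Homology at position 0 is the image modulo the variables times it, which minimal generators span
    degree by degree. If row [a] were a boundary, it would yield a syzygy with constant term 1 at
    [a]. *)
Lemma generator_kacyc q : mxminimal ->
  (exists a, d a = q) <-> ~ kacyc d' (immod M) 0 q.
Proof.
move=> minM; split=> [[a da] ac|nac].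
  pose c (A : {set T}) := if A == set0 then row a M else 0.
  have cM : kchain d' (immod M) 0 q c.
    move=> A; rewrite /c; case: eqVneq => [->|ne]; split=> //.
    - by exists (delta_mx 0 a); rewrite rowE.
    - by apply/hprojP => b m; rewrite mxE => /hM; rewrite cards0 addn0 da.
    - by rewrite cards0.
    - by exists 0; rewrite mul0mx.
    - by rewrite raddf0.
  have [|b bM bc] := ac c cM; first by move=> A; apply: kbd_position cM.
  have [f _ fM] := kchain_lift hM bM.
  have /minM/(_ a) : kermod M (delta_mx 0 a - kbd f set0).
    rewrite /kermod mulmxBl -kbd_mulmx (eq_bd _ _ fM) bc /c eqxx rowE.
    by rewrite subrr.
  rewrite mxE [X in _ + X]mxE mcoeffB kbd_const mxE !eqxx mcoeff1 eqxx subr0.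
  by move/eqP; rewrite oner_eq0.
have [//|na] := classic (exists a, d a = q); case: nac => c cM c0.
have [f fT fM] := kchain_lift hM cM.
have [A||g gT gc] := kchain_free_exact fT.
- exact: kbd_position fT.
- right=> A b; have [_ /hprojP/(_ b 0%MM) + n] := fT A.
  rewrite mdeg0 add0n; have [A0|/n ->] := eqVneq #|A| 0%N;
    last by rewrite mxE mcoeff0.
  rewrite A0 addn0; have [//|_ /(_ isT) e] := eqVneq (f A 0 b)@_0%MM 0.
  by case: na; exists b.
exists (fun A => g A *m M) => [|A]; first exact: kchain_mulmx gT.
by rewrite kbd_mulmx gc.
Qed.

End Shift.
End Graded.

(** * Minimal generators and resolutions *)

(** [P] is an arbitrary predicate, so the spanning family is found classically: a vector outside the
    current span raises the rank, which is at most [n]. *)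
Lemma subspace_spanned (k : fieldType) n (P : 'rV[k]_n -> Prop) :
    P 0 -> (forall a v w, P v -> P w -> P (a *: v + w)) ->
  exists r (A : 'M[k]_(r, n)), (forall i, P (row i A)) /\
    forall v, P v -> (v <= A)%MS.
Proof.
move=> P0 PD.
suff h j : forall r (A : 'M[k]_(r, n)), (forall i, P (row i A)) ->
    (n <= \rank A + j)%N ->
    exists r (A : 'M[k]_(r, n)), (forall i, P (row i A)) /\
      forall v, P v -> (v <= A)%MS.
  by apply: (h n 0%N (0 : 'M_(0, n))) => [[]|] //; rewrite leq_addl.
elim: j => [|j IHj] r A PA le.
  exists r, A; split=> // v _; apply: submx_full.
  by rewrite /row_full eqn_leq rank_leq_col -{1}(addn0 (\rank A)).
have [gA|nA] := classic (forall v, P v -> (v <= A)%MS); first by exists r, A.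
have [v nv] := not_all_ex_not _ _ nA; have [Pv /negP {}nv] := imply_to_and _ _ nv.
apply: (IHj _ (col_mx A v)) => [i|].
  rewrite -(splitK i); case: (split i) => j' /=.
    by rewrite rowKu.
  by rewrite rowKd row_id.
apply: leq_trans le _; rewrite addnS -addSn leq_add2r -addsmxE rank_ltmx //.
by rewrite ltmxE addsmxSl /= addsmx_sub submx_refl.
Qed.

Section Generation.
Variables (T : finType) (k : fieldType).
Local Notation S := {mpoly k[#|T|]}.

Lemma submodule_mulmx r c (Z : 'rV[S]_c -> Prop) (M : 'M[S]_(r, c)) v :
  submodule Z -> (forall i, Z (row i M)) -> Z (v *m M).
Proof. by move=> Zs ZM; rewrite mulmx_sum_row; apply: submodule_sum. Qed.

Variables (c : nat) (dc : 'I_c -> nat) (Z : 'rV[S]_c -> Prop).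
Hypothesis Zs : submodule Z.

(** The degree-[q] part of [Z] lives in a finite-dimensional space over [k], with one coordinate for
    each component and monomial of degree at most [q]. *)
Lemma degree_spanned q : exists r (M : 'M[S]_(r, c)),
  [/\ forall i, Z (row i M), forall i, hproj dc 0 q (row i M) = row i M &
      forall v, Z v -> hproj dc 0 q v = v -> immod M v].
Proof.
have [Z0 ZD] := Zs.
pose D := ('I_c * 'X_{1..#|T| < q.+1})%type.
pose dec (u : 'rV[k]_#|{: D}|) : 'rV[S]_c :=
  \row_b \sum_(m : 'X_{1..#|T| < q.+1}) u 0 (enum_rank ((b, m) : D)) *: 'X_[m].
have decD a u w : dec (a *: u + w) = a%:MP *: dec u + dec w.
  apply/rowP => b; rewrite !mxE mulr_sumr -big_split; apply: eq_bigr => m _ /=.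
  by rewrite !mxE scalerDl mul_mpolyC scalerA.
have dec0 : dec 0 = 0.
  by apply/rowP => b; rewrite !mxE big1 // => m _; rewrite mxE scale0r.
have hprojZC a v : hproj dc 0 q (a%:MP *: v) = a%:MP *: hproj dc 0 q v.
  by apply: hprojZ => m; rewrite mcoeffC; case: (eqVneq m 0%MM) => [->|_];
    rewrite ?mdeg0 // mulr0 eqxx.
have [||r [A [PA sA]]] := @subspace_spanned k _
  (fun u => Z (dec u) /\ hproj dc 0 q (dec u) = dec u).
- by rewrite dec0 raddf0.
- move=> a v w [Zv pv] [Zw pw]; rewrite decD raddfD /= hprojZC pv pw.
  by split=> //; apply: ZD.
exists r, (\matrix_i dec (row i A)); split=> [i|i|v Zv pv].
- by rewrite rowK; have [] := PA i.
- by rewrite rowK; have [] := PA i.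
pose enc : 'rV[k]_#|{: D}| :=
  \row_(i < #|{: D}|) (v 0 (enum_val i : D).1)@_((enum_val i : D).2).
have encK : dec enc = v.
  apply/rowP => b; apply/mpolyP => m; rewrite mxE.
  transitivity ((\sum_(m : 'X_{1..#|T| < q.+1}) (v 0 b)@_m *: 'X_[m])@_m).
    by congr (_ @_ _); apply: eq_bigr => m' _; rewrite mxE enum_rankK.
  apply: (mcoeff_boundedsum (E := fun m => (v 0 b)@_m)) => m'.
  by move/hprojP: pv => /(_ b m') h /h <-; rewrite ltnS leq_addr.
have /submxP[w ew] : (enc <= A)%MS by apply: sA; rewrite encK.
exists (map_mx (@mpolyC _ k) w); rewrite -{1}encK ew.
apply/rowP => b; rewrite !mxE.
under eq_bigr do rewrite mxE scaler_suml.
rewrite exchange_big; apply: eq_bigr => i _ /=.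
rewrite !mxE mulr_sumr; apply: eq_bigr => m _.
by rewrite mul_mpolyC mxE scalerA.
Qed.

Lemma immod_sub r (M : 'M[S]_(r, c)) : (forall i, Z (row i M)) ->
  forall v, immod M v -> Z v.
Proof. by move=> ZM _ [w ->]; apply: submodule_mulmx. Qed.

Lemma low_degrees_spanned N : exists r (d : 'I_r -> nat) (M : 'M[S]_(r, c)),
  [/\ mxhomog d dc M, forall i, Z (row i M) &
      forall q v, (q < N)%N -> Z v -> hproj dc 0 q v = v -> immod M v].
Proof.
elim: N => [|N [r [d [M [hM ZM gM]]]]].
  by exists 0%N, (fun=> 0%N), 0; split=> // [[]|[]].
have [r1 [M1 [Z1 p1 g1]]] := degree_spanned N.
exists (r + r1)%N, (fun i => match split i with inl a => d a | inr _ => N end), (col_mx M M1).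
split=> [i b m|i|q v].
- rewrite mxE; case: (split i) => a; first exact: hM.
  by move/hprojP: (p1 a) => /(_ b m); rewrite mxE addn0.
- by rewrite -(splitK i); case: (split i) => a /=; rewrite ?rowKu ?rowKd.
rewrite ltnS leq_eqVlt => /orP[/eqP ->|lt] Zv pv.
  have [w ->] := g1 v Zv pv; exists (row_mx 0 w).
  by rewrite mul_row_col mul0mx add0r.
have [w ->] := gM q v lt Zv pv; exists (row_mx w 0).
by rewrite mul_row_col mul0mx addr0.
Qed.

Lemma sum_hproj (v : 'rV[S]_c) : exists K, v = \sum_(q < K) hproj dc 0 q v.
Proof.
exists (\max_b (msize (v 0%R b) + dc b)).+1%N.
apply/rowP => b; apply/mpolyP => m; rewrite summxE raddf_sum /=.
have [z|nz] := eqVneq (v 0 b)@_m 0.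
  by rewrite z big1 // => q _; rewrite mxE mcoeff_homog_part z if_same.
have lt : (mdeg m + dc b < (\max_b (msize (v 0%R b) + dc b)).+1)%N.
  rewrite ltnS; apply: leq_trans (leq_bigmax b).
  by rewrite leq_add2r ltnW // msize_mdeg_lt // mcoeff_msupp.
rewrite (bigD1 (Ordinal lt)) //= mxE mcoeff_homog_part addn0 eqxx big1 ?addr0 // => q.
by rewrite mxE mcoeff_homog_part addn0 -val_eqE /= eq_sym => /negPf ->.
Qed.

Hypothesis Zgr : forall q v, Z v -> Z (hproj dc 0 q v).
Variable sg : T -> {set T} -> bool.

(** Vanishing at position 0 writes an element of degree above [N] as a combination of variables
    times elements of [Z] one degree lower. Hence generators of degree at most [N] suffice. *)
Lemma finitely_generated N : (forall q, (N < q)%N -> kacyc sg dc Z 0 q) ->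
  exists r (d : 'I_r -> nat) (M : 'M[S]_(r, c)),
    mxhomog d dc M /\ forall v, Z v <-> immod M v.
Proof.
move=> ac; have [r [d [M [hM ZM gM]]]] := low_degrees_spanned N.+1.
exists r, d, M; split=> // v; split; last exact: immod_sub.
suff gen q w : Z w -> hproj dc 0 q w = w -> immod M w.
  move=> Zv; have [K ->] := sum_hproj v.
  rewrite (eq_bigr (fun q : 'I_K => 1 *: hproj dc 0 q v)) => [|q _];
    last by rewrite scale1r.
  apply: submodule_sum => [|q _]; first exact: immod_submodule.
  by apply: (gen q); [apply: Zgr | rewrite hproj_id].
elim: q w => [|q IHq] w Zw pw; first exact: (gM 0%N).
have [le|lt] := leqP q.+1 N; first exact: (gM q.+1).
pose cw (A : {set T}) := if A == set0 then w else 0.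
have cwZ : kchain dc Z 0 q.+1 cw.
  move=> A; rewrite /cw; case: eqVneq => [->|ne]; split=> //;
    rewrite ?cards0 ?raddf0 //.
  by have [] := Zs.
have [A|b bZ bc] := ac _ lt cw cwZ; first exact: kbd_position cwZ.
have -> : w = bd sg (@xvar T k) b set0 by rewrite bc /cw eqxx.
apply: submodule_sum => [|x x0]; first exact: immod_submodule.
have [Zb /hprojP pb _] := bZ (x |: set0); apply: IHq => //.
by apply/hprojP => i m /pb; rewrite cardsU1 x0 cards0; lia.
Qed.

(** A syzygy with a nonzero constant term at [b] expresses row [b] through the others; deleting that
    row is an induction on the number of rows. *)
Lemma minimally_generated r (d : 'I_r -> nat) (M : 'M[S]_(r, c)) :
    mxhomog d dc M -> (forall v, Z v <-> immod M v) ->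
  exists r (d : 'I_r -> nat) (M : 'M[S]_(r, c)),
    [/\ mxhomog d dc M, forall v, Z v <-> immod M v & mxminimal M].
Proof.
elim: r d M => [|r IHr] d M hM ZM; first by exists 0%N, d, M; split=> // v _ [].
have [?|nM] := classic (mxminimal M); first by exists r.+1, d, M.
have [v0 nv0] := not_all_ex_not _ _ nM; have [kv0 nb] := imply_to_and _ _ nv0.
have [b /eqP nz] := not_all_ex_not _ _ nb.
(* In degree [d b] the entry at [b] is a nonzero scalar, hence invertible. *)
pose v := hproj d 0 (d b) v0.
have kv : v *m M = 0 by rewrite -(hprojM _ _ _ hM) (kv0 : _ = 0) raddf0.
pose a := (v0 0 b)@_0%MM.
have vb : v 0 b = a%:MP.
  apply/mpolyP => m; rewrite mxE mcoeff_homog_part mcoeffC addn0 -{2}(add0n (d b)) eqn_add2r mdeg_eq0.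
  by case: (eqVneq m 0%MM) => [->|_]; rewrite ?mulr1 ?mulr0.
apply: (IHr (d \o lift b) (row' b M)) => [i j m|u].
  by rewrite mxE; apply: hM.
split=> [/ZM[w ->] {u}|].
  pose u := w - (w 0 b * a^-1%:MP) *: v.
  have ub : u 0 b = 0.
    have : u 0 b = w 0 b - (w 0 b * a^-1%:MP) * v 0 b by rewrite !mxE.
    by move=> ->; rewrite vb -mulrA -mpolyCM mulVf // mpolyC1 mulr1 subrr.
  exists (col' b u); rewrite -[LHS]subr0 -[0](scaler0 _ (w 0 b * a^-1%:MP)) -kv.
  rewrite scalemxAl -mulmxBl; apply/rowP => j; rewrite !mxE (bigD1_ord b) //=.
  by rewrite ub mul0r add0r; apply: eq_bigr => i _; rewrite !mxE.
apply: immod_sub => i.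
have -> : row i (row' b M) = row (lift b i) M by apply/rowP => j; rewrite !mxE.
by apply/ZM; exists (delta_mx 0 (lift b i)); rewrite rowE.
Qed.

End Generation.

(** * Construction of minimal free resolutions and their comparison with Koszul homology *)

Section Resolution.
Variables (T : finType) (k : fieldType).
Local Notation S := {mpoly k[#|T|]}.
Variable sg : T -> {set T} -> bool.
Hypothesis altsg : alternating sg.
Variable I : S -> Prop.

Definition ideal_vector (v : 'rV[S]_1) := I (v 0 0).
Local Notation d0 := (fun _ : 'I_1 => 0%N).

Section Existence.
Variable N : nat.

(** One map of the resolution under construction. The bound [N] is the same at every stage, which
    keeps each successive kernel finitely generated. *)
Record stage := Stage {
  st_c : nat; st_r : nat;
  st_dc : 'I_st_c -> nat; st_dr : 'I_st_r -> nat;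
  st_M : 'M[S]_(st_r, st_c);
  st_homog : mxhomog st_dr st_dc st_M;
  st_min : mxminimal st_M;
  st_acyc : forall i q, (N < q)%N -> kacyc sg st_dc (immod st_M) i q }.


Definition generators c := {r : nat & ('I_r -> nat) * 'M[S]_(r, c)}%type.

Definition good_generators c (dc : 'I_c -> nat) (Z : 'rV[S]_c -> Prop)
    (x : generators c) :=
  [/\ mxhomog (projT2 x).1 dc (projT2 x).2, forall v, Z v <-> immod (projT2 x).2 v,
      mxminimal (projT2 x).2 &
      forall i q, (N < q)%N -> kacyc sg dc (immod (projT2 x).2) i q].

Lemma good_generators_exist c (dc : 'I_c -> nat) (Z : 'rV[S]_c -> Prop) :
    submodule Z -> (forall q v, Z v -> Z (hproj dc 0 q v)) ->
    (forall i q, (N < q)%N -> kacyc sg dc Z i q) ->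
  exists x, good_generators dc Z x.
Proof.
move=> Zs Zgr ac.
have [r0 [d1 [M0 [h0 Z0]]]] := finitely_generated Zs Zgr (ac 0%N).
have [r [d [M [hM ZM minM]]]] := minimally_generated Zs h0 Z0.
exists (existT _ r (d, M)); split=> // i q lt.
exact: eq_kacyc ZM (ac i q lt).
Qed.

Definition stage_of c (dc : 'I_c -> nat) (Z : 'rV[S]_c -> Prop) x
    (h : good_generators dc Z x) : stage :=
  @Stage c (projT1 x) dc (projT2 x).1 (projT2 x).2
    (let: And4 h _ _ _ := h in h) (let: And4 _ _ m _ := h in m)
    (let: And4 _ _ _ a := h in a).

(** Dimension shifting passes the vanishing above [N] from the image to the kernel, so the kernel is
    again minimally generated by finitely many elements. *)
Lemma next_stage (s : stage) : exists x, good_generators (@st_dr s) (kermod (st_M s)) x.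
Proof.
apply: good_generators_exist; first exact: kermod_submodule.
  by move=> q v kv; rewrite /kermod -(hprojM _ _ _ (@st_homog s)) (kv : _ = 0) raddf0.
move=> i q lt; apply: (kacyc_ker_of_im altsg (@st_homog s)); last exact: st_acyc.
by right; apply: st_min.
Qed.

Definition next (s : stage) : stage :=
  stage_of (proj2_sig (constructive_indefinite_description _ (next_stage s))).

Lemma next_exact (s : stage) (v : 'rV_(st_r s)) :
  kermod (st_M s) v <-> immod (st_M (next s)) v.
Proof.
have [_ h _ _] := proj2_sig (constructive_indefinite_description _ (next_stage s)).
exact: h.
Qed.

Hypothesis Is : submodule ideal_vector.
Hypothesis Igr : forall q v, ideal_vector v -> ideal_vector (hproj d0 0 q v).
Hypothesis Iac : forall i q, (N < q)%N -> kacyc sg d0 ideal_vector i q.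

Lemma mulmx_const r r' (w : 'rV[S]_r) (M : 'M[S]_(r, r')) b :
  (forall a, (M a b)@_0%MM = 0) -> ((w *m M) 0 b)@_0%MM = 0.
Proof.
move=> M0; rewrite mxE raddf_sum big1 // => a _ /=.
by rewrite rmorphM /= M0 mulr0.
Qed.

Theorem min_free_res_exists : inhabited (min_free_res I).
Proof.
have [x0 x0P] := good_generators_exist Is Igr Iac.
pose st := fix st p := if p is p'.+1 then next (st p') else stage_of x0P.
have [h0 i0 m0 _] := x0P.
constructor.
apply: (@MinFreeRes k _ I (fun p => st_r (st p)) (fun p => @st_dr (st p))
  (projT2 x0).2 (fun p => st_M (st p.+1))).
- move=> a; apply/dhomogP => m; rewrite mcoeff_msupp => /h0 /=.
  by rewrite addn0.
- by move=> p a b m; rewrite mcoeff_msupp; apply: (@st_homog (st p.+1)).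
- move=> f; have := i0 (\row__ f); rewrite /ideal_vector mxE => e.
  rewrite e; split=> -[v ev]; exists v; first by rewrite -ev mxE.
  by apply/rowP => j; rewrite !ord1 mxE -ev.
- move=> v; apply: (iff_trans (next_exact (s := st 0%N) v)).
  by split=> -[w ew]; exists w.
- move=> p v; apply: (iff_trans (next_exact (s := st p.+1) v)).
  by split=> -[w ew]; exists w.
(* A row of the next matrix is a syzygy of the current one, which is minimal. *)
move=> p a b; have := @st_min (st p) (row a (st_M (st p.+1))) _ b.
rewrite mxE; apply; apply/(next_exact (s := st p)).
by exists (delta_mx 0 a); apply: rowE.
Qed.

End Existence.

Section Betti.
Variable F : min_free_res I.

Definition mfr_syzygy p : 'rV[S]_(mfr_rank F p) -> Prop :=
  match p with
  | 0 => kermod (mfr_aug F)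
  | p'.+1 => kermod (mfr_diff F p')
  end.

Lemma mfr_syzygy_im p v : mfr_syzygy v <-> immod (mfr_diff F p) v.
Proof.
case: p v => [|p] v; [have e := mfr_exact0 v | have e := mfr_exactS v];
  by split=> [/e[w ew]|[w ew]]; [exists w | apply/e; exists w].
Qed.

Lemma mfr_aug_mxhomog : mxhomog (@mfr_deg _ _ _ F 0) d0 (mfr_aug F).
Proof.
move=> a b m; rewrite ord1 -mcoeff_msupp addn0.
by have /dhomogP h := mfr_aug_homog a; move/h.
Qed.

Lemma mfr_diff_mxhomog p :
  mxhomog (@mfr_deg _ _ _ F p.+1) (@mfr_deg _ _ _ F p) (mfr_diff F p).
Proof. by move=> a b m; rewrite -mcoeff_msupp; apply: mfr_diff_homog. Qed.

Lemma mfr_syzygy_minimal p v : mfr_syzygy (p := p) v -> forall b, (v 0 b)@_0%MM = 0.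
Proof.
by move/mfr_syzygy_im => [w ->] b; apply: mulmx_const => a; apply: mfr_minimal.
Qed.

Lemma mfr_aug_im v : ideal_vector v <-> immod (mfr_aug F) v.
Proof.
apply: (iff_trans (mfr_exact_aug F (v 0 0))); split=> -[w ew]; exists w.
  by apply/rowP => j; rewrite !ord1 -ew.
by rewrite ew.
Qed.

(** Each step down the resolution shifts the homological position by one; the last shift passes from
    the kernel of the augmentation to the ideal. *)
Lemma mfr_syzygy_kacyc p i q :
  kacyc sg (@mfr_deg _ _ _ F p) (@mfr_syzygy p) i q <->
  kacyc sg d0 ideal_vector (p + i).+1 q.
Proof.
elim: p i => [|p IHp] i.
  rewrite add0n; split=> [ac|ac].
    apply: (eq_kacyc (Z := immod (mfr_aug F))); first by move=> v; apply: iff_sym;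
      apply: mfr_aug_im.
    exact: (kacyc_im_of_ker altsg mfr_aug_mxhomog ac).
  apply: (kacyc_ker_of_im altsg mfr_aug_mxhomog);
    last exact: (eq_kacyc mfr_aug_im ac).
  by right; apply: (@mfr_syzygy_minimal 0).
rewrite addSnnS; apply: iff_trans (IHp i.+1).
split=> ac.
  apply: (eq_kacyc (Z := immod (mfr_diff F p))).
    by move=> v; apply: iff_sym; apply: mfr_syzygy_im.
  exact: (kacyc_im_of_ker altsg (@mfr_diff_mxhomog p) ac).
apply: (kacyc_ker_of_im altsg (@mfr_diff_mxhomog p)).
  by right; apply: (@mfr_syzygy_minimal p.+1).
exact: (eq_kacyc (@mfr_syzygy_im p) ac).
Qed.

(** The module [F_p] minimally generates the ideal or a syzygy module, so its degrees are read off
    from homology at position 0 and shifted to position [p] of the ideal. *)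
Theorem mfr_deg_kacyc p q :
  (exists a, @mfr_deg _ _ _ F p a = q) <-> ~ kacyc sg d0 ideal_vector p q.
Proof.
case: p => [|p].
  apply: (iff_trans (generator_kacyc altsg mfr_aug_mxhomog _ (@mfr_syzygy_minimal 0))).
  split=> nac ac; apply: nac; apply: eq_kacyc ac => v; first exact: mfr_aug_im.
  by apply: iff_sym; apply: mfr_aug_im.
apply: (iff_trans (generator_kacyc altsg (@mfr_diff_mxhomog p) _ (@mfr_syzygy_minimal p.+1))).
have := mfr_syzygy_kacyc p 0 q; rewrite addn0 => e.
split=> nac ac; apply: nac.
  by apply: (eq_kacyc (@mfr_syzygy_im p)); apply/e.
by apply/e; apply: (eq_kacyc _ ac) => v; apply: iff_sym; apply: mfr_syzygy_im.
Qed.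

End Betti.

(** The criterion holds for every minimal resolution, in particular for the one behind the value
    picked by [epsilon]. *)
Lemma betti_kacyc p q : inhabited (min_free_res I) ->
  betti I p q <> 0%N <-> ~ kacyc sg d0 ideal_vector p q.
Proof.
move=> [F0]; rewrite /betti; set P := fun b => _.
have : exists b, P b by eexists; exists F0.
move/(epsilon_spec (inhabits 0%N)) => [F ->].
rewrite -(mfr_deg_kacyc F); split=> [/eqP|[a da]].
  by rewrite cards_eq0 => /set0Pn[a]; rewrite inE => /eqP; exists a.
by move/eqP; rewrite cards_eq0 => /eqP/setP/(_ a); rewrite !inE da eqxx.
Qed.

End Resolution.

(** * Betti numbers of nonedge ideals *)

Definition nonclique (T : finType) (G : rel T) (B : {set T}) : bool :=
  [exists u in B, exists v in B, (u != v) && ~~ G u v].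

Lemma noncliqueP (T : finType) (G : rel T) (B : {set T}) :
  reflect (exists u v, [/\ u \in B, v \in B, u != v & ~~ G u v]) (nonclique G B).
Proof.
apply: (iffP exists_inP) => [[u uB /exists_inP[v vB /andP[ne nG]]]|[u [v [uB vB ne nG]]]].
  by exists u, v.
by exists u => //; apply/exists_inP; exists v; rewrite ?ne.
Qed.

Lemma nonclique_sub (T : finType) (G : rel T) (A B : {set T}) :
  A \subset B -> nonclique G A -> nonclique G B.
Proof.
move=> /subsetP s /noncliqueP[u [v [uA vA ne nG]]].
by apply/noncliqueP; exists u, v; split=> //; apply: s.
Qed.

Definition rank_sign (T : finType) (v : T) (A : {set T}) : bool :=
  odd #|[set u in A | enum_rank u < enum_rank v]%N|.

Lemma rank_sign_alternating (T : finType) : alternating (@rank_sign T).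
Proof.
move=> v w A ne vA wA.
have sU x y : x \notin A -> rank_sign y (x |: A) = (enum_rank x < enum_rank y)%N (+) rank_sign y A.
  move=> xA; rewrite /rank_sign; set B := [set u in A | _].
  have [lt|le] := boolP (enum_rank x < enum_rank y)%N.
    have -> : [set u in x |: A | (enum_rank u < enum_rank y)%N] = x |: B.
      by apply/setP=> u; rewrite !inE; case: eqVneq => // ->.
    by rewrite cardsU1 inE (negPf xA) oddD.
  rewrite addFb; congr (odd _); apply: eq_card => u; rewrite !inE.
  by case: eqVneq => // ->; rewrite (negPf le) !andbF.
rewrite !sU //; have : enum_rank v != enum_rank w :> nat.
  by apply: contraNneq ne => /val_inj/enum_rank_inj ->.
by case: ltngtP => // _ _; case: (rank_sign v A); case: (rank_sign w A).
Qed.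

Section Graph.
Variables (T : finType) (k : fieldType) (G : rel T).
Local Notation S := {mpoly k[#|T|]}.

Definition nonclique_monomial (m : 'X_{1..#|T|}) := nonclique G (msup m).

(** Alexander dual, on the vertex set [W], of the clique complex of the graph induced on [W]. *)
Definition gfamily (W : {set T}) : pred {set T} :=
  fun A => (A \subset W) && nonclique G (W :\: A).

Variable sg : T -> {set T} -> bool.
Hypothesis altsg : alternating sg.

Lemma msup_mset (W A : {set T}) : msup (mset W - mset A)%MM = W :\: A.
Proof.
by apply/setP=> v; rewrite !inE mnmBE !msetE; case: (v \in W); case: (v \in A).
Qed.

Lemma mfamily_mset W : mfamily nonclique_monomial (mset W) =1 gfamily W.
Proof.
move=> A; rewrite /mfamily /gfamily /nonclique_monomial msup_mset;
  congr ((_ \subset _) && _).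
by rewrite -{2}(setD0 W) -msup_mset mset0 subm0.
Qed.

Lemma mset_msup (m : 'X_{1..#|T|}) : (forall v, m (enum_rank v) <= 1)%N -> m = mset (msup m).
Proof.
move=> le; apply: mnm_rankP => v; rewrite msetE inE.
by have := le v; case: (m _) => [|[]].
Qed.

(** When [v] has exponent at least 2, removing it once leaves it in the support, so the family is a
    cone with apex [v]. Only squarefree multidegrees can then carry homology. *)
Lemma mfamily_square p (m : 'X_{1..#|T|}) v : (1 < m (enum_rank v))%N ->
  sacyc sg k (mfamily nonclique_monomial m) p.
Proof.
move=> lt; apply: (sacyc_cone altsg (v := v)) => A /andP[sA ncA].
rewrite /mfamily subUset sub1set inE sA -lt0n (ltnW lt) /=.
apply: nonclique_sub ncA; apply/subsetP=> u; rewrite !inE !mnmBE !msetE in_setU1.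
by case: (eqVneq u v) => [->|//] _; rewrite -lt0n subn_gt0 lt.
Qed.

Lemma pacyc_gfamily p q :
  pacyc k sg nonclique_monomial 0 p q <->
  forall W : {set T}, #|W| = q -> sacyc sg k (gfamily W) p.
Proof.
split=> [ac W Wq|ac].
  apply: eq_sacyc (mfamily_mset W) _; apply: sacyc_of_pacyc ac.
  by rewrite mdeg_mset addn0.
apply: pacyc_of_sacyc => m; rewrite addn0 => mq.
have [/existsP[v /mfamily_square]|/existsPn le] := boolP [exists v, 1 < m (enum_rank v)]%N.
  exact.
have em : m = mset (msup m) by apply: mset_msup => v; rewrite leqNgt le.
rewrite em; apply: eq_sacyc (fun A => esym (mfamily_mset _ A)) _.
by apply: ac; rewrite -mq [in RHS]em mdeg_mset.
Qed.

End Graph.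

Section Ideal.
Variables (T : finType) (k : fieldType) (G : sgraph T).
Local Notation S := {mpoly k[#|T|]}.
Local Notation I := (@nonedge_ideal k T G).
Local Notation d0 := (fun _ : 'I_1 => 0%N).

Lemma nonedge_ideal_linear a f g : I f -> I g -> I (a * f + g).
Proof.
move=> [c ->] [c' ->]; exists (fun u v => a * c u v + c' u v).
rewrite mulr_sumr -big_split; apply: eq_bigr => u _ /=.
rewrite mulr_sumr -big_split; apply: eq_bigr => v _ /=.
by rewrite mulrDl mulrA.
Qed.

Lemma nonedge_ideal0 : I 0.
Proof.
by exists (fun _ _ => 0); rewrite big1 // => u _; rewrite big1 // => v _;
  rewrite mul0r.
Qed.

Lemma nonedge_idealX m : nonclique_monomial G m -> I 'X_[m].
Proof.
move=> /noncliqueP[u [v [+ + ne nG]]]; rewrite !inE => mu mv.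
pose x : 'X_{1..#|T|} := (m - U_(enum_rank u) - U_(enum_rank v))%MM.
exists (fun u' v' => if (u' == u) && (v' == v) then 'X_[x] else 0).
rewrite (bigD1 u) //= (bigD1 v) ?ne //= !eqxx.
rewrite !big1 ?addr0 => [|u' /negPf ne'|v' /andP[_ /negPf ne']].
- rewrite -!mpolyXD [(_ + U_(enum_rank v))%MM]addmC addmA !submK ?lep1mP //.
  rewrite mnmBE mnm1E (inj_eq enum_rank_inj) (negPf ne) subn0 //.
- by rewrite big1 // => v' _; rewrite ne' mul0r.
- by rewrite ne' mul0r.
Qed.

Lemma nonedge_idealP f : I f <-> forall m, f@_m != 0 -> nonclique_monomial G m.
Proof.
split=> [[c ->] m nz|h].
  apply: contraNT nz => ncl; rewrite raddf_sum big1 // => u _ /=.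
  rewrite raddf_sum big1 // => v /andP[ne nG] /=.
  rewrite mulrC -mulrA !mcoeff_XM mnmBE mnm1E (inj_eq enum_rank_inj) (negPf ne) subn0.
  case: ifP => // mu; case: ifP => // mv; case/noncliqueP: ncl.
  by exists u, v; rewrite !inE.
rewrite [f]mpolyE big_seq; elim/big_rec: _ => [|m g mf Ig];
  first exact: nonedge_ideal0.
rewrite -mul_mpolyC; apply: nonedge_ideal_linear => //.
by apply/nonedge_idealX/h; rewrite -mcoeff_msupp.
Qed.

Lemma nonedge_submodule : submodule (ideal_vector I).
Proof.
rewrite /ideal_vector; split=> [|a v w Iv Iw]; first by rewrite mxE;
  apply: nonedge_ideal0.
by rewrite !mxE; apply: nonedge_ideal_linear.
Qed.

Lemma nonedge_graded q v : ideal_vector I v -> ideal_vector I (hproj d0 0 q v).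
Proof.
move=> /nonedge_idealP h; apply/nonedge_idealP => m; rewrite mxE mcoeff_homog_part.
by case: ifP => _; [apply: h | rewrite eqxx].
Qed.

Variable sg : T -> {set T} -> bool.
Hypothesis altsg : alternating sg.

Lemma kacyc_nonedge p q :
  kacyc sg d0 (ideal_vector I) p q <-> pacyc k sg (nonclique_monomial G) 0 p q.
Proof.
have toP r (c : {set T} -> 'rV[S]_1) : kchain d0 (ideal_vector I) r q c ->
    pchain (nonclique_monomial G) 0 r q (fun A => c A 0 0).
  move=> cI A m nz; have [/nonedge_idealP/(_ _ nz) -> /hprojP/(_ _ _ nz) e n] := cI A.
  rewrite addn0 -e add0n eqxx /=; apply: contraR nz => /n ->.
  by rewrite mxE mcoeff0.
have toK r (c : {set T} -> S) : pchain (nonclique_monomial G) 0 r q c ->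
    kchain d0 (ideal_vector I) r q (fun A => \row__ c A).
  move=> cI A; split.
  - by rewrite /ideal_vector mxE; apply/nonedge_idealP => m /cI /and3P[].
  - by apply/hprojP => b m; rewrite mxE => /cI /and3P[_ /eqP <- _]; rewrite addn0.
  - move=> ne; apply/rowP => b; rewrite !mxE; apply/eqP; rewrite -mleadc_eq0.
    by apply: contraNT ne => /cI /and3P[].
split=> ac c cI c0.
  have [A|b bI bc] := ac _ (toK _ _ cI).
    by apply/rowP => j; rewrite ord1 kbd_comp mxE (eq_bd _ _ (c2 := c)) // => B;
      rewrite mxE.
  exists (fun A => b A 0 0); first exact: toP.
  by move=> A; rewrite -kbd_comp bc mxE.
have [A|b bI bc] := ac _ (toP _ _ cI); first by rewrite -kbd_comp c0 mxE.
exists (fun A => \row__ (b A : S)); first exact: toK.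
move=> A; apply/rowP => j; rewrite !ord1 kbd_comp -bc (eq_bd _ _ (c2 := b)) // => B.
by rewrite mxE.
Qed.

(* A form of Hochster's formula, for the Alexander dual of the clique complex. *)
Theorem betti_nonedge p q : betti I p q <> 0%N <->
  exists W : {set T}, #|W| = q /\ ~ sacyc sg k (gfamily G W) p.
Proof.
have ac i j : kacyc sg d0 (ideal_vector I) i j <->
    forall W : {set T}, #|W| = j -> sacyc sg k (gfamily G W) i.
  exact: (iff_trans (kacyc_nonedge i j) (pacyc_gfamily k G altsg i j)).
(* No vertex set has more than [#|T|] elements, so Koszul homology vanishes in degrees above
   [#|T|]. *)
have ex : inhabited (min_free_res I).
  apply: (min_free_res_exists altsg nonedge_submodule nonedge_graded (N := #|T|)).
  by move=> i j lt; apply/ac => W Wj; have := max_card W; rewrite Wj leqNgt lt.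
apply: (iff_trans (betti_kacyc altsg p q ex));
  split=> [nac|[W [Wq nW]] /ac/(_ W Wq) //].
apply: NNPP => nW; apply/nac/ac => W Wq; apply: NNPP => nac'.
by apply: nW; exists W.
Qed.

End Ideal.

Lemma is_max_exists (P : nat -> Prop) N :
  (exists r, P r) -> (forall r, P r -> (r <= N)%N) -> exists r, is_max P r.
Proof.
elim: N => [|N IHN] [r Pr] le.
  by exists r; split=> // s /le; have /le := Pr; lia.
have [PN|nPN] := classic (P N.+1); first by exists N.+1.
apply: IHN => [|s Ps]; first by exists r.
by have := le s Ps; rewrite leq_eqVlt => /orP[/eqP e|//]; rewrite e in Ps.
Qed.

Lemma reg_is_max (T : finType) (k : fieldType) (G : sgraph T) sg :
  alternating sg -> ~~ complete G ->
  is_max (fun r => exists p (W : {set T}), #|W| = (p + r)%N /\ ~ sacyc sg k (gfamily G W) p)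
    (reg k G).
Proof.
move=> altsg nc; pose P r := exists p, betti (@nonedge_ideal k T G) p (p + r) <> 0%N.
have PE r : P r <-> exists p (W : {set T}), #|W| = (p + r)%N /\ ~ sacyc sg k (gfamily G W) p.
  by split=> -[p]; [move/(betti_nonedge _ _ altsg) | move=> h]; exists p => //;
    apply/(betti_nonedge _ _ altsg).
suff [Pr max] : is_max P (reg k G).
  by split=> [|s /PE/max //]; apply/PE.
rewrite /reg (negPf nc); apply: epsilon_spec.
apply: (@is_max_exists _ #|T|) => [|r /PE[p [W [Wr _]]]]; last first.
  by have := max_card W; lia.
(* A nonedge [uv] gives a generator of degree 2: for [W = [set u; v]] the only face is the empty
   set, which is a cycle but bounds nothing. *)
exists 2%N; apply/PE; exists 0%N.
have [u [v [ne nG]]] : exists u v, u != v /\ ~~ G u v.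
  have /forallPn[u /forallPn[v]] := nc; rewrite negb_imply => /andP[ne nG].
  by exists u, v.
exists [set u; v]; split; first by rewrite cards2 ne.
pose c (A : {set T}) : k^o := if A == set0 then 1 else 0.
move=> /(_ c)[A|A|b bP /(_ set0)].
- rewrite /c; case: (eqVneq A set0) => [-> _|]; last by rewrite eqxx.
  rewrite cards0 /gfamily sub0set setD0 /= andbT; apply/noncliqueP.
  by exists u, v; rewrite !inE !eqxx orbT.
- rewrite /bd big1 // => w _; rewrite /c; case: eqVneq => [/setP/(_ w)|_];
  last by rewrite scaler0.
  by rewrite !inE eqxx.
rewrite /c eqxx /bd big1 => [|w _]; first by move/esym/eqP; rewrite oner_eq0.
apply/eqP; apply: contraT => nz.
have : b (w |: set0) != 0 by apply: contraNneq nz => ->; rewrite scaler0.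
rewrite setU0 => /bP /andP[/andP[+ /noncliqueP[x [y [+ + + _]]]] _].
rewrite sub1set !inE => wuv.
by case/andP=> xw /orP[]/eqP ex /andP[yw /orP[]/eqP ey]; subst; rewrite ?eqxx //;
   case/orP: wuv => /eqP e; subst; rewrite ?eqxx in xw yw.
Qed.

(** * Edge deletion *)

Section SubsetTransport.
Variables (T : finType) (N U : {set T}) (sg : T -> {set T} -> bool).
Hypotheses (altsg : alternating sg) (UN : [disjoint U & N]).
Local Notation sT := {x : T | x \in N}.

Definition shift (B : {set sT}) : {set T} := U :|: val @: B.
Definition shift_sign (x : sT) (B : {set sT}) := sg (val x) (shift B).

Lemma mem_shift (x : sT) B : (val x \in shift B) = (x \in B).
Proof.
rewrite inE (mem_imset _ _ val_inj).
by rewrite (disjointFl UN) //; apply: valP.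
Qed.

Lemma shiftU1 x B : shift (x |: B) = val x |: shift B.
Proof. by rewrite /shift imsetU1 setUCA. Qed.

Lemma card_shift B : #|shift B| = (#|U| + #|B|)%N.
Proof.
rewrite cardsU card_imset ?disjoint_setI0 ?cards0 ?subn0 //; last exact: val_inj.
apply: disjointWr UN; apply/subsetP => _ /imsetP[x _ ->]; exact: valP.
Qed.

Lemma shift_sign_alternating : alternating shift_sign.
Proof.
move=> v w B ne vB wB; rewrite /shift_sign !shiftU1.
by apply: altsg; rewrite ?mem_shift // (inj_eq val_inj).
Qed.

(** Vertices outside [N] contribute nothing to the boundary at a shifted set, so the sum runs over
    [N] alone. *)
Lemma bd_shift (k : fieldType) (f : {set T} -> k^o) (g : {set sT} -> k^o) (B : {set sT}) :
    (forall x, x \notin B -> f (val x |: shift B) = g (x |: B)) ->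
    (forall v, v \notin N -> v \notin shift B -> f (v |: shift B) = 0) ->
  bd sg (fun=> 1) f (shift B) = bd shift_sign (fun=> 1) g B.
Proof.
move=> fg f0; rewrite /bd (bigID (mem N)) /= addrC big1 ?add0r => [|v /andP[vB vN]]; last first.
  by rewrite f0 // scaler0.
have [x0|nx] := pickP {: sT}; last first.
  rewrite !big_pred0 // => [x|v]; first by have := nx x.
  by apply/negP => /andP[_ vN]; have := nx (Sub v vN).
move=> _; rewrite (reindex_onto val (insubd x0)) => [|v /andP[_ vN]];
  last by rewrite insubdK.
apply: eq_big => [x|x]; first by rewrite mem_shift valKd eqxx (valP x) !andbT.
by rewrite mem_shift => /andP[/andP[xB _] _]; rewrite fg.
Qed.

End SubsetTransport.

(** * Correcting a bounding chain on the faces gained by edge deletion *)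

Section MayerVietoris.
Variables (T : finType) (k : fieldType) (G : sgraph T) (i j : T).
Hypothesis ij : G i j.
Variable sg : T -> {set T} -> bool.
Hypothesis altsg : alternating sg.

Local Notation N := (edge_nbhd G i j).
Local Notation G' := (del_edge G i j).
Local Notation H := (edge_graph_del G i j).
Local Notation sT := {x : T | x \in N}.
Local Notation i' := (edge_graph_l G i j).

Lemma nonclique_edge_graph_del (C : {set sT}) :
  nonclique H C = nonclique G' (val @: C).
Proof.
have adjE (x y : sT) : H x y = G' (val x) (val y).
  rewrite /= /del_adj /= /induced_adj; congr (_ && ~~ _).
  rewrite -(inj_eq (imset_inj val_inj)) !imsetU !imset_set1 //.
apply/noncliqueP/noncliqueP => [[x [y [xC yC ne nH]]]|].
  by exists (val x), (val y); rewrite !mem_imset ?(inj_eq val_inj) -?adjE //;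
    apply: val_inj.
move=> [_ [_ [/imsetP[x xC ->] /imsetP[y yC ->] ne nG]]].
by exists x, y; rewrite adjE -(inj_eq val_inj).
Qed.

Lemma nonclique_del (B : {set T}) : nonclique G B -> nonclique G' B.
Proof.
move=> /noncliqueP[u [v [uB vB ne nG]]]; apply/noncliqueP; exists u, v.
by rewrite /= /del_adj negb_and nG.
Qed.

Variable W : {set T}.
Local Notation U := (W :\: N).
Definition trace : {set sT} := [set x | val x \in W].
Local Notation phi := (@shift T N U).

Lemma outside_disjoint : [disjoint U & N].
Proof. by rewrite -setI_eq0; apply/eqP/setP => x;
  rewrite in_setI in_setD in_set0 andbAC andNb. Qed.

Lemma setD_shift (B : {set sT}) : W :\: phi B = val @: (trace :\: B).
Proof.
apply/setP => v; rewrite inE; have [vN|vN] := boolP (v \in N).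
  have -> : v = val (Sub v vN : sT) by rewrite SubK.
  by rewrite (mem_shift outside_disjoint) (mem_imset _ _ val_inj) in_setD [_ \in trace]inE.
apply/andP/imsetP => [[]|[x _ e]]; last by rewrite e (valP x) in vN.
by rewrite in_setU in_setD vN /= => /norP[/negPf ->].
Qed.

Lemma shift_trace : phi trace = W.
Proof.
apply/setP => v; rewrite in_setU in_setD; case: (boolP (v \in N)) => vN /=.
  have -> : v = val (Sub v vN : sT) by rewrite SubK.
  by rewrite (mem_imset _ _ val_inj) inE.
apply/orP/idP => [[//|/imsetP[x _ e]]|]; last by left.
by rewrite e (valP x) in vN.
Qed.

(* The faces gained by deleting the edge: the complement in [W] is a clique
   containing the edge. *)
Definition new_face (A : {set T}) := [&& A \subset W, nonclique G' (W :\: A) & ~~ nonclique G (W :\: A)].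

(** The only pair that is a nonedge of [G'] but not of [G] is the pair [i], [j]. *)
Lemma new_face_ends A : new_face A -> (i \in W :\: A) && (j \in W :\: A).
Proof.
move=> /and3P[_ /noncliqueP[u [v [uA vA ne +]]] cG].
have Guv : G u v.
  by apply: contraNT cG => nG; apply/noncliqueP; exists u, v.
rewrite /= /del_adj Guv /= negbK => /eqP e.
by apply/andP; split; [have : i \in [set u; v] by rewrite e !inE eqxx
  | have : j \in [set u; v] by rewrite e !inE eqxx orbT];
  rewrite !inE => /orP[]/eqP ->; rewrite -in_setD.
Qed.

(** A vertex outside [N] is nonadjacent to [i] or to [j], so it cannot lie in a clique containing
    both. *)
Lemma new_face_outside A : new_face A -> U \subset A.
Proof.
move=> nA; have /andP[iA jA] := new_face_ends nA; have /and3P[_ _ cG] := nA.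
apply/subsetP => v; rewrite in_setD => /andP[vN vW]; apply: contraNT cG => vA.
have vWA : v \in W :\: A by rewrite in_setD vA.
move: vN; rewrite !inE !negb_or negb_and => /andP[/andP[vi vj] /orP[] nG];
  apply/noncliqueP; [exists i, v | exists j, v]; split=> //; by rewrite eq_sym.
Qed.

Definition restrict (A : {set T}) : {set sT} := [set x | val x \in A].

Lemma restrict_shift (B : {set sT}) : restrict (phi B) = B.
Proof. by apply/setP => x; rewrite inE (mem_shift outside_disjoint). Qed.

Lemma shift_restrict A : new_face A -> phi (restrict A) = A.
Proof.
move=> nA; have /and3P[/subsetP AW _ _] := nA;
  have /subsetP UA := new_face_outside nA.
apply/setP => v; have [vN|vN] := boolP (v \in N).
  have -> : v = val (Sub v vN : sT) by rewrite SubK.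
  by rewrite (mem_shift outside_disjoint) inE.
apply/idP/idP => [|vA]; last by rewrite in_setU in_setD vN AW.
rewrite in_setU => /orP[/UA //|/imsetP[x _ e]]; by rewrite e (valP x) in vN.
Qed.

Lemma new_faceU1 A v : new_face A -> v |: A \subset W ->
  nonclique G' (W :\: (v |: A)) -> new_face (v |: A).
Proof.
move=> /and3P[_ _ cG] sW ncl; apply/and3P; split=> //.
apply: contra cG; apply: nonclique_sub.
by apply: setDS; apply: subsetUr.
Qed.

Local Notation sgU := (shift_sign (N := N) U sg).
Let altU : alternating sgU := shift_sign_alternating altsg outside_disjoint.

(** Let [b] bound [c] for [G'] and let [a] be its part on new faces. The boundary [z] of the cone
    over [a] bounds some [y] for [H], and subtracting the boundary of the extension [yhat] of [y]
    clears [b] of new faces without changing its boundary. *)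
Lemma sacyc_mayer_vietoris p :
    sacyc sg k (gfamily G' W) p ->
    (forall p', (#|U| + p' = p.+1)%N -> sacyc sgU k (gfamily H trace) p') ->
  sacyc sg k (gfamily G W) p.
Proof.
move=> acG' acH c cG c0.
have cG' : schain (gfamily G' W) p c.
  by move=> A /cG /andP[/andP[sA /nonclique_del ncl] ->]; rewrite /gfamily sA ncl.
have {acG'} [b bG' bc] := acG' c cG' c0.
have [/existsP[A0 /andP[nzA0 newA0]]|/existsPn nonew] :=
    boolP [exists A, (b A != 0) && new_face A]; last first.
  exists b => // A nz; have /andP[/andP[sA ncl] ->] := bG' A nz.
  have := nonew A; rewrite nz /= /new_face sA ncl /= negbK => ncG.
  by rewrite /gfamily sA ncG.
have A0p : #|A0| = p.+1 by have /andP[_ /eqP] := bG' A0 nzA0.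
(* A new face in the support of [b] contains [U], so [p'] is an honest difference of [p.+1] and
   [#|U|]. *)
pose p' := #|restrict A0|.
have Up : (#|U| + p' = p.+1)%N.
  by rewrite -A0p -[in RHS](shift_restrict newA0) (card_shift outside_disjoint).
pose a (B : {set sT}) : k^o := if new_face (phi B) then b (phi B) else 0.
(* At a new face the boundaries of [a] and [b] agree, since larger faces of [G'] are again new; and
   [c], being a chain for [G], vanishes there. *)
have bd_a B : new_face (phi B) -> bd sgU (fun=> 1) a B = 0.
  move=> newB; have /and3P[sB _ cliqueB] := newB.
  transitivity (c (phi B)).
    rewrite -bc; symmetry; apply: (bd_shift sg outside_disjoint) => [x xB|v vN vB].
      rewrite /a shiftU1; case: ifP => // nnew; apply/eqP;
        apply: contraFT nnew => nz.
      by have /andP[/andP[sxB nclx] _] := bG' _ nz; apply: new_faceU1.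
    apply/eqP; apply: contraNT vB => /bG' /andP[/andP[/subsetP sv _] _].
    by rewrite in_setU in_setD vN sv // setU11.
  by apply/eqP; apply: contraNT cliqueB => /cG /andP[/andP[]].
pose z := bd sgU (fun=> 1) (cone sgU i' a).
have zE B : z B = a B - cone sgU i' (bd sgU (fun=> 1) a) B by apply: bd_cone.
have aH B : a B != 0 -> [&& B \subset trace, new_face (phi B) & #|B| == p'].
  rewrite /a; case: ifP => [newB nz|]; last by rewrite eqxx.
  have /and3P[/subsetP sB _ _] := newB; apply/and3P; split=> //.
    by apply/subsetP => x xB; rewrite inE sB // (mem_shift outside_disjoint).
  have /andP[_] := bG' _ nz.
  by rewrite (card_shift outside_disjoint) -Up eqn_add2l.
have zH : schain (gfamily H trace) p' z.
  move=> B nz; have [aB|aB] := eqVneq (a B) 0; last first.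
    have /and3P[sB newB ->] := aH B aB; have /and3P[_ ncl _] := newB.
    by rewrite /gfamily sB nonclique_edge_graph_del -setD_shift ncl.
  (* The remaining support comes from the cone: [B] is [B0] with [i] added, and the boundary of [a]
     is nonzero at [B0]. *)
  move: nz; rewrite zE aB sub0r oppr_eq0 /cone; case: ifP => [iB|];
    last by rewrite eqxx.
  rewrite mulf_eq0 negb_or => /andP[_]; set B0 := B :\ i' => nz.
  have [x xB0 nza] : exists2 x, x \notin B0 & a (x |: B0) != 0.
    apply/exists_inP; apply: contraNT nz; rewrite negb_exists_in => /forall_inP h.
    by rewrite /bd big1 // => x /h /negPn/eqP ->; rewrite scaler0.
  have /and3P[sxB newx /eqP px] := aH _ nza.
  have eB : B = i' |: B0 by rewrite setD1K.
  have iB0 : i' \notin B0 by rewrite setD11.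
  have sB : B \subset trace.
    rewrite eB subUset sub1set inE /=; have /andP[+ _] := new_face_ends newx.
    by rewrite inE => /andP[_ ->]; apply: subset_trans sxB; apply: subsetUr.
  have Bp : #|B| = p' by rewrite eB -px !cardsU1 iB0 xB0.
  rewrite /gfamily sB Bp eqxx andbT /=; apply: contraNT nz => clH.
  apply/eqP; apply: bd_a.
  have sub : phi B0 \subset phi (x |: B0) by rewrite shiftU1 subsetUr.
  have /and3P[sW ncl _] := newx.
  apply/and3P; split; first exact: subset_trans sub sW.
    by apply: nonclique_sub ncl; apply: setDS.
  apply: contra clH; rewrite setD_shift => /noncliqueP[_ [_ [/imsetP[u uB ->] /imsetP[v vB ->] ne nG]]].
  (* In [G] the vertex [i] is adjacent to all other vertices of [N], so a nonedge in the complement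
     of [B0] avoids [i] and survives in the complement of [B]. *)
  have Gi (w : sT) : val w != i -> G i (val w).
    by move=> wi; have := valP w;
      rewrite !inE (negPf wi) /= => /orP[/eqP ->|/andP[]].
  have ui : val u != i.
    by apply: contraNneq nG => e; rewrite e Gi //; apply: contraNneq ne => ->;
      rewrite e.
  have vi : val v != i.
    by apply: contraNneq nG => e; rewrite e adj_sym Gi.
  apply/noncliqueP; exists u, v; split.
  - by move: uB; rewrite !inE -(inj_eq val_inj) /= ui.
  - by move: vB; rewrite !inE -(inj_eq val_inj) /= vi.
  - by apply: contraNneq ne => ->.
  - by rewrite /= /del_adj /= /induced_adj negb_and nG.
have [B|y yH yz] := acH p' Up z zH; first exact: (bd_bd altU).
pose yhat A : k^o := if new_face A then y (restrict A) else 0.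
have yhatP A : bd sg (fun=> 1) yhat A != 0 ->
    [&& A \subset W, nonclique G' (W :\: A) & #|A| == p.+1].
  move=> nz; have [v vA nzy] : exists2 v, v \notin A & yhat (v |: A) != 0.
    apply/exists_inP; apply: contraNT nz; rewrite negb_exists_in => /forall_inP h.
    by rewrite /bd big1 // => v /h /negPn/eqP ->; rewrite scaler0.
  move: nzy; rewrite /yhat; case: ifP => [new|]; last by rewrite eqxx.
  move=> /yH /andP[_ /eqP cy]; have /and3P[sW ncl _] := new; apply/and3P; split.
  - by apply: subset_trans sW; apply: subsetUr.
  - by apply: nonclique_sub ncl; apply: setDS; apply: subsetUr.
  have := congr1 (fun A : {set T} => #|A|) (shift_restrict new).
  by rewrite (card_shift outside_disjoint) cy addnS Up cardsU1 vA add1n => -[->].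
exists (fun A => b A - bd sg (fun=> 1) yhat A) => [A nz|A]; last first.
  by rewrite bdB (bd_bd altsg) subr0.
have /and3P[sA nclA ->] : [&& A \subset W, nonclique G' (W :\: A) & #|A| == p.+1].
  have [bA|/bG' /andP[/andP[-> ->] ->] //] := eqVneq (b A) 0.
  by apply: yhatP; move: nz; rewrite bA sub0r oppr_eq0.
rewrite /gfamily sA andbT /=; apply: contraNT nz => clA.
(* On a new face [a - z] is the cone of the boundary of [a], supported on sets containing [i]; new
   faces avoid [i]. *)
have new : new_face A by apply/and3P.
have eA := shift_restrict new; set B := restrict A in eA; rewrite -eA.
have -> : bd sg (fun=> 1) yhat (phi B) = bd sgU (fun=> 1) y B.
  apply: (bd_shift sg outside_disjoint) => [x xB|v vN vB].
    rewrite -shiftU1 /yhat restrict_shift; case: ifP => // nnew.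
    apply/esym/eqP; apply: contraFT nnew => /yH /andP[/andP[sx nclx] _].
    rewrite shiftU1; apply: new_faceU1; rewrite -?shiftU1; first by rewrite eA.
      have : phi (x |: B) \subset phi trace by apply: setUS; apply: imsetS.
      by rewrite shift_trace.
    by rewrite setD_shift -nonclique_edge_graph_del.
  rewrite /yhat; case: ifP => // /and3P[/subsetP sv _ _].
  by case/negP: vB; rewrite in_setU in_setD vN sv // setU11.
rewrite yz zE /a eA new opprB addrC subrK /cone.
have /andP[+ _] := new_face_ends new; rewrite !inE => /andP[/negPf iA _].
by rewrite iA.
Qed.

End MayerVietoris.

Theorem theorem1p9 (k : fieldType) (char0 : [pchar k]%R =i pred0)
    (T : finType) (G : sgraph T) (i j : T) (ij : G i j) :
  (reg k G <= maxn (reg k (del_edge G i j)) (reg k (edge_graph_del G i j) + 1))%N.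
Proof.
(* For complete [G] the left side is 1 by convention. *)
have [cG|ncG] := boolP (complete G); first by rewrite /reg cG leq_max addn1 orbT.
have ne : i != j by apply: contraTneq ij => ->; rewrite adj_irr.
have ncG' : ~~ complete (del_edge G i j).
  apply/forallPn; exists i; apply/forallPn; exists j.
  by rewrite ne /= /del_adj eqxx andbF.
have ncH : ~~ complete (edge_graph_del G i j).
  apply/forallPn; exists (edge_graph_l G i j); apply/forallPn;
    exists (edge_graph_r G i j).
  by rewrite -(inj_eq val_inj) /= ne /= /del_adj eqxx andbF.
have alt := @rank_sign_alternating T.
have [[p [W [Wr nac]]] _] := reg_is_max k alt ncG.
have [acG'|nacG'] := classic (sacyc (@rank_sign T) k (gfamily (del_edge G i j) W) p); last first.
  have [_ max] := reg_is_max k alt ncG'.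
  by rewrite leq_max max //; exists p, W.
have dis := outside_disjoint G i j W.
have [_ max] := reg_is_max k (shift_sign_alternating alt dis) ncH.
have [p' [Up nacH]] : exists p', (#|W :\: edge_nbhd G i j| + p' = p.+1)%N /\
    ~ sacyc (shift_sign (W :\: edge_nbhd G i j) (@rank_sign T)) k
        (gfamily (edge_graph_del G i j) (trace G i j W)) p'.
  apply: NNPP => h; apply: nac; apply: (sacyc_mayer_vietoris ij alt acG') => p' Up.
  by apply: NNPP => nacH; apply: h; exists p'.
have cW : #|W| = (#|W :\: edge_nbhd G i j| + #|trace G i j W|)%N.
  by rewrite -{1}(shift_trace G i j W) (card_shift dis).
(* With [reg k G = r'.+1], the equations [#|W| = p + r'.+1], [#|U| + p' = p.+1] and
   [#|W| = #|U| + #|trace|], where [U] is [W] outside the edge neighbourhood, give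
   [#|trace| = p' + r']. *)
case r: (reg k G) => [|r'] //; rewrite leq_max addn1 ltnS max ?orbT //.
exists p', (trace G i j W); split=> //.
apply: (@addnI #|W :\: edge_nbhd G i j|).
by rewrite addnA Up addSnnS -r -Wr cW.
Qed.
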